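(* Define two irreducible pairs of linear maps $(A_1,A_2), (B_1,B_2)\in \mathrm{GL}_2(\mathbb{R})^2$ by $$A_1:=\begin{pmatrix}2&0\\0&1\end{pmatrix}, \quad A_2:= \begin{pmatrix}0&1\\1&0\end{pmatrix},\quad B_1:=\begin{pmatrix}0&1\\1&0\end{pmatrix}, \quad B_2:= \begin{pmatrix}1&0\\0&2\end{pmatrix}$$ and let $\beta_1,\beta_2>0$ be arbitrary. Define a potential $\Phi \colon \Sigma_2^* \to (0,+\infty)$ by $\Phi(\mathtt{i}):=\|A_{\mathtt{i}}\|^{\beta_1}\|B_{\mathtt{i}}\|^{\beta_2}$. Then $\Phi$ has a unique equilibrium state and this equilibrium state is not totally ergodic.
   Context: $\Sigma_2:=\{1,2\}^{\mathbb{N}}$ carries the product topology and $\sigma[(x_k)_{k\ge1}]:=(x_{k+1})_{k\ge 1}$. $\mathcal{M}_\sigma(\Sigma_2)$ is the set of $\sigma$-invariant Borel probability measures on $\Sigma_2$. $\Sigma_2^*$ is the set of all finite nonempty words $\mathtt{i}=(i_1,\ldots,i_n)$ over $\{1,2\}$; $|\mathtt{i}|=n$. For $x\in\Sigma_2$, $x|_n:=(x_1,\ldots,x_n)$. $A_{\mathtt{i}}:=A_{i_1}A_{i_2}\cdots A_{i_n}$ and similarly $B_{\mathtt{i}}$; $\|\cdot\|$ is the Euclidean operator norm. A pair is irreducible if no nonzero proper linear subspace is preserved by both of its maps. $\Phi$ is submultiplicative, and $P(\Phi):=\lim_{n\to\infty}\frac1n\log\sum_{|\mathtt{i}|=n}\Phi(\mathtt{i})$,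 $\Lambda(\Phi,\mu):=\lim_{n\to\infty}\frac1n\int\log\Phi(x|_n)\,d\mu(x)$ for $\mu\in\mathcal{M}_\sigma(\Sigma_2)$. An equilibrium state of $\Phi$ is $\mu\in\mathcal{M}_\sigma(\Sigma_2)$ with $P(\Phi)=h(\mu)+\Lambda(\Phi,\mu)$, where $h$ is entropy. A measure $\mu \in \mathcal{M}_\sigma(\Sigma_2)$ is totally ergodic if it is ergodic with respect to $\sigma^n$ for every $n\ge1$. *)

(* Defs.v *)
From HB Require Import structures.
From mathcomp Require Import all_boot all_order all_algebra.
From mathcomp Require Import all_classical all_reals all_analysis.

Set Implicit Arguments.
Unset Strict Implicit.
Unset Printing Implicit Defensive.
Import Order.TTheory GRing.Theory Num.Theory.
Import numFieldNormedType.Exports.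

Local Open Scope classical_set_scope.
Local Open Scope ring_scope.

(* The alphabet {1, 2} is coded by bool, false standing for the symbol 1 and
   true for the symbol 2; finite words are sequences of booleans, and positions
   are numbered from 0.  [cantor_space] is nat -> bool with the product of the
   discrete topologies. *)
Definition Sigma2 := g_sigma_algebraType (@open cantor_space).

Definition left_shift (x : Sigma2) : Sigma2 := fun k => x k.+1.

Definition prefix_word (n : nat) (x : Sigma2) : seq bool := mkseq x n.

Section MeasureTheoreticEntropy.
Context (d : measure_display) (T : measurableType d) (R : realType).
Implicit Types (mu : probability T R) (f : T -> T).

Definition invariant_measure mu f :=
  forall A : set T, measurable A -> mu (f @^-1` A) = mu A.

Definition ergodic mu f :=
  forall A : set T, measurable A -> f @^-1` A = A ->
    mu A = 0%E \/ mu A = 1%E.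

(* Some cells may be empty; they contribute nothing to the entropy. *)
Definition measurable_partition (k : nat) (P : 'I_k -> set T) :=
  [/\ forall i, measurable (P i), trivIset setT P & \bigcup_i P i = setT].

(* The cell of P \/ f^-1 P \/ ... \/ f^-(n-1) P with itinerary w. *)
Definition join_cell f (k : nat) (P : 'I_k -> set T) (n : nat)
    (w : n.-tuple 'I_k) : set T :=
  [set x | forall j : 'I_n, P (tnth w j) (iter j f x)].

(* [ln 0 = 0] in the library, so null cells contribute 0. *)
Definition join_entropy mu f (k : nat) (P : 'I_k -> set T) (n : nat) : R :=
  - \sum_(w : n.-tuple 'I_k)
      fine (mu (join_cell f P w)) * ln (fine (mu (join_cell f P w))).

Definition partition_entropy mu f (k : nat) (P : 'I_k -> set T) : \bar R :=
  limn (fun n => ((n%:R)^-1 * join_entropy mu f P n)%:E).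

(* Kolmogorov-Sinai entropy *)
Definition entropy mu f : \bar R :=
  ereal_sup [set h | exists (k : nat) (P : 'I_k -> set T),
    measurable_partition P /\ h = partition_entropy mu f P].

End MeasureTheoreticEntropy.

Section Thermodynamics.
Context (R : realType).
Implicit Types (Phi : seq bool -> R) (mu : probability Sigma2 R).

(* A potential is used on nonempty words only: the terms of index n = 0 below
   do not affect the limits.  The limits are taken in the extended reals. *)
Definition pressure Phi : \bar R :=
  limn (fun n => ((n%:R)^-1 * ln (\sum_(w : n.-tuple bool) Phi w))%:E).

Definition Lyapunov Phi mu : \bar R :=
  limn (fun n =>
    ((n%:R)^-1)%:E * \int[mu]_x (ln (Phi (prefix_word n x)))%:E)%E.

Definition equilibrium_state Phi mu :=
  invariant_measure mu left_shift /\
  pressure Phi = (entropy mu left_shift + Lyapunov Phi mu)%E.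

Definition totally_ergodic mu :=
  forall n : nat, (0 < n)%N -> ergodic mu (iter n left_shift).

End Thermodynamics.

Section Matrices.
Context (R : realType).

(* The norm of the library on matrices is the sup norm. *)
Definition euclidean_norm (n : nat) (v : 'cV[R]_n) : R :=
  Num.sqrt (\sum_i v i 0 ^+ 2).

Definition operator_norm (n : nat) (M : 'M[R]_n) : R :=
  sup [set euclidean_norm (M *m v) |
       v in [set v : 'cV[R]_n | euclidean_norm v <= 1]].

(* M_(w_1) M_(w_2) ... M_(w_n), in this order *)
Definition word_product (M : bool -> 'M[R]_2) (w : seq bool) : 'M[R]_2 :=
  \prod_(a <- w) M a.

Definition irreducible_pair (M : bool -> 'M[R]_2) :=
  forall V : {vspace 'cV[R]_2},
    (forall a v, v \in V -> M a *m v \in V) -> V = 0%VS \/ V = fullv.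

Definition mx2 (a b c d : R) : 'M[R]_2 :=
  \matrix_(i, j) (if i == 0 then if j == 0 then a else b
                  else if j == 0 then c else d).

Definition matA (a : bool) : 'M[R]_2 :=
  if a then mx2 0 1 1 0 else mx2 2 0 0 1.

Definition matB (a : bool) : 'M[R]_2 :=
  if a then mx2 1 0 0 2 else mx2 0 1 1 0.

Definition norm_potential (beta1 beta2 : R) (w : seq bool) : R :=
  operator_norm (word_product matA w) `^ beta1 *
  operator_norm (word_product matB w) `^ beta2.

End Matrices.

(* Main.v *)
Require Import Defs.
From HB Require Import structures.
From mathcomp Require Import all_boot all_order all_algebra.
From mathcomp Require Import all_classical all_reals all_analysis.
From mathcomp Require Import measurable_realfun ring lra.

(** The matrices are monomial, so [norm_potential] is comparable, up to a
    factor 4, to the sum over the four states [(s, t)] (the parities of the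
    number of symbols 2 and of symbols 1 read so far) of a product of letter
    weights.  These weights turn the four states into a weighted 4-cycle, and
    the Perron eigenvector of that cycle gives a shift-invariant measure mu with
    the Gibbs property mu[w] ~ Phi(w) exp(- |w| P).

    By the Gibbs property, h(nu) + Lambda(nu) - P is, up to bounded terms, the
    limit of - D_n / n, where D_n is the relative entropy of nu with respect to
    mu on words of length n.  Subadditivity of entropy and of log Phi makes D_n
    bounded when nu is an equilibrium state.  Since Birkhoff averages of
    cylinders have variance O(1/n) under mu, the variational characterisation
    of relative entropy then forces nu and mu to agree on every cylinder.

    The 4-cycle is bipartite, and the word 112 has different frequencies along
    the two parity classes.  The asymptotic sign of its alternating frequency
    defines a set which is invariant under the square of the shift and disjoint
    from its preimage under the shift; it has measure strictly between 0 and 1. *)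

Set Implicit Arguments.
Unset Strict Implicit.
Unset Printing Implicit Defensive.
Import Order.TTheory GRing.Theory Num.Theory.
Import numFieldNormedType.Exports.

Local Open Scope classical_set_scope.
Local Open Scope ring_scope.

(** * Sums over words, Gibbs' inequality and Fekete's lemma *)

(** The cycle has the parameters [u = 2 ^ beta1] and [v = 2 ^ beta2], both above 1. The norm of a
    monomial matrix with positive entries is its larger entry, so Phi(w) is exactly the largest of
    the four path weights, and the factor 4 is the price of passing from maximum to sum. Each letter
    acts on the states as an involution and weighs an edge equally in both directions; hence the
    Perron vector is a left and a right eigenvector at once, and its square is the stationary law.
    The obstacle is periodicity: the chain is irreducible but not mixing, so correlations need not
    decay. The Poisson equation is still solvable for centred functions, and this alone gives
    variances linear in n. Birkhoff sums are allowed to depend on the hidden state because the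
    alternating frequency concentrates around a constant only after multiplication by the parity
    sign of the initial state. No ergodic theorem is used: Chebyshev bounds of order 1/n are
    summable along the times [2 ^ k], which is why the final invariant set looks at these times
    only. *)

Section word_sums.
Variables (V : nmodType).
Implicit Types f : seq bool -> V.

Lemma sum_word0 f : \sum_(w : 0.-tuple bool) f w = f [::].
Proof.
rewrite (bigD1 [tuple]) //= big1 ?addr0 // => w; rewrite tuple0; by case/eqP.
Qed.

Lemma sum_wordS n f : \sum_(w : n.+1.-tuple bool) f w =
  \sum_(a : bool) \sum_(w : n.-tuple bool) f (a :: w).
Proof.
rewrite pair_bigA /=.
pose F (p : bool * n.-tuple bool) := [tuple of p.1 :: p.2].
rewrite (reindex F) //=; exists (fun w => (thead w, [tuple of behead w])).
  by move=> [a w] _; rewrite /F /=; congr pair; apply/val_inj.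
by move=> w _; rewrite /F /= [RHS]tuple_eta.
Qed.

Lemma sum_wordD n m f : \sum_(w : (n + m).-tuple bool) f w =
  \sum_(w : n.-tuple bool) \sum_(v : m.-tuple bool) f (w ++ v).
Proof.
elim: n f => [|n IH] f; first by rewrite (sum_word0 (fun w => \sum_v f (w ++ _))).
rewrite sum_wordS (sum_wordS _ (fun w => \sum_v f (w ++ _))).
by apply: eq_bigr => a _; rewrite -(IH (fun w => f (a :: w))).
Qed.

Lemma sum_wordSr n f : \sum_(w : n.+1.-tuple bool) f w =
  \sum_(w : n.-tuple bool) \sum_(a : bool) f (rcons w a).
Proof.
rewrite -[in LHS]addn1 sum_wordD; apply: eq_bigr => w _.
rewrite (sum_wordS _ (fun v => f (w ++ v))); apply: eq_bigr => a _.
by rewrite (sum_word0 (fun v => f (w ++ a :: v))) cats1.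
Qed.

End word_sums.

Section gibbs_inequality.
Variable R : realType.
Implicit Types x y : R.

Lemma mul_lnB_le x y : 0 <= x -> 0 < y -> x * (ln y - ln x) <= y - x.
Proof.
rewrite le_eqVlt => /predU1P[<- y0|x0 y0]; first by rewrite mul0r subr0 ltW.
rewrite -ln_div ?posrE//.
have := @le_ln1Dx R (y / x - 1); rewrite ltrBrDl subrr divr_gt0// addrC subrK => /(_ isT) h.
have := ler_wpM2l (ltW x0) h; rewrite mulrBr mulr1 [x * (y / x)]mulrC -mulrA.
by rewrite mulVf ?mulr1// gt_eqF.
Qed.

Lemma gibbs_inequality (I : finType) (p q : I -> R) :
  (forall i, 0 <= p i) -> (forall i, 0 <= q i) ->
  (forall i, q i = 0 -> p i = 0) -> \sum_i q i <= \sum_i p i ->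
  - \sum_i p i * ln (p i) <= - \sum_i p i * ln (q i).
Proof.
move=> p0 q0 pq sq; rewrite lerN2 -subr_le0 -sumrB.
apply: (@le_trans _ _ (\sum_i (q i - p i))); last by rewrite sumrB subr_le0.
apply: ler_sum => i _; rewrite -mulrBr.
have := q0 i; rewrite le_eqVlt => /predU1P[/esym qi|qi].
  by rewrite qi (pq _ qi) mul0r subrr.
exact: mul_lnB_le.
Qed.

(** The Donsker-Varadhan inequality in a form without logarithm of the exponential moment: it is the
    pointwise bound [mul_lnB_le] against the tilted weights [q i * expR (g i)], whose total mass
    need not be 1. *)
Lemma gibbs_variational (I : finType) (p q g : I -> R) :
  (forall i, 0 <= p i) -> (forall i, 0 < q i) ->
  \sum_i p i * g i <= \sum_i p i * (ln (p i) - ln (q i))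
    + (\sum_i q i * expR (g i) - \sum_i p i).
Proof.
move=> p0 q0; rewrite -lerBlDl -!sumrB; apply: ler_sum => i _.
have -> : p i * g i - p i * (ln (p i) - ln (q i)) =
    p i * (ln (q i * expR (g i)) - ln (p i)).
  by rewrite lnM ?posrE ?expR_gt0// expRK; ring.
by apply: mul_lnB_le => //; rewrite mulr_gt0 ?expR_gt0.
Qed.

(** Merging atoms lowers entropy: [p i] is at most the mass of its fibre and [ln] is monotone. *)
Lemma entropy_map_le (I J : finType) (f : I -> J) (p : I -> R) (r : J -> R) :
  (forall i, 0 <= p i) -> (forall j, r j = \sum_(i | f i == j) p i) ->
  - \sum_j r j * ln (r j) <= - \sum_i p i * ln (p i).
Proof.
move=> p0 rE; rewrite lerN2 (partition_big f xpredT)//=; apply: ler_sum => j _.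
rewrite {1}rE mulr_suml; apply: ler_sum => i fi.
have := p0 i; rewrite le_eqVlt => /predU1P[<-|pi]; first by rewrite !mul0r.
apply: ler_wpM2l => //.
have pr : p i <= r j by rewrite rE (bigD1 i)//= lerDl sumr_ge0.
by rewrite ler_ln ?posrE// (lt_le_trans pi pr).
Qed.

End gibbs_inequality.

Section fekete.
Variable R : realType.
Implicit Types a : nat -> R.

(** The limit is the infimum of the ratios, whence the bound at every [n]. That bound, more than the
    convergence, is what uniqueness rests on: it controls free energies with no error term. *)
Lemma fekete a : (forall n, 0 <= a n) -> (forall n m, a (n + m)%N <= a n + a m) ->
  exists l, [/\ 0 <= l, forall n, n%:R * l <= a n &
    (fun n => n%:R^-1 * a n) @ \oo --> l].
Proof.
move=> a0 aD.
have aM n k : a (k * n)%N <= k%:R * a n + a 0%N.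
  elim: k => [|k IH]; first by rewrite mul0n mul0r add0r.
  rewrite mulSn; apply: (le_trans (aD _ _)); rewrite -natr1 mulrDl mul1r.
  by rewrite [_ * _ + _]addrC -addrA lerD2l.
pose S := [set x | exists2 n, (0 < n)%N & x = n%:R^-1 * a n].
have Slb : lbound S 0.
  by move=> _ [n n0 ->]; rewrite mulr_ge0// invr_ge0.
have Sne : S !=set0 by exists (1^-1 * a 1%N); exists 1%N.
have Sinf : has_inf S by split => //; exists 0.
have l0 : 0 <= inf S by apply: lb_le_inf.
(* Euclidean division of [n] by [m]; the constant absorbs the finitely many remainders, and [a 0],
   which may be positive. *)
have aN m (m0 : (0 < m)%N) : exists C, forall n, a n <= (n%:R * (m%:R^-1 * a m)) + C.
  pose B := \sum_(r < m) a r.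
  have rB r : (r < m)%N -> a r <= B.
    by move=> rm; rewrite /B (bigD1 (Ordinal rm))//= lerDl sumr_ge0.
  exists (a 0%N + B) => n; rewrite {1}(divn_eq n m).
  apply: (le_trans (aD _ _)); rewrite addrA; apply: lerD; last by rewrite rB// ltn_mod.
  apply: (le_trans (aM _ _)); rewrite lerD2r mulrA; apply: ler_wpM2r => //.
  by rewrite ler_pdivlMr ?ltr0n// -natrM ler_nat leq_trunc_div.
exists (inf S); split => //.
  move=> [|n]; first by rewrite mul0r.
  rewrite -ler_pdivlMl//; apply: ge_inf; first by exists 0.
  by exists n.+1.
apply/cvgrPdist_lt => e e0.
have e2 : 0 < e / 2 by rewrite divr_gt0.
have [_ [m m0 ->] mS] := inf_adherent e2 Sinf.
have [C HC] := aN m m0.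
have [N NC] : exists N : nat, C / (e / 2) < N%:R.
  exists (Num.bound `|C / (e / 2)|); apply: le_lt_trans (ler_norm _) _.
  by apply: archi_boundP; exact: normr_ge0.
exists N.+1 => // n /= Nn.
have n0 : 0 < n%:R :> R by rewrite ltr0n (leq_trans _ Nn).
have lo : inf S <= n%:R^-1 * a n.
  by apply: ge_inf; [exists 0|exists n => //; rewrite (leq_trans _ Nn)].
rewrite distrC ger0_norm ?subr_ge0// ltrBlDl.
have -> : inf S + e = (inf S + e / 2) + e / 2 by field.
rewrite mulrC ltr_pdivrMr//.
apply: le_lt_trans (HC n) _; rewrite mulrDl ltrD//.
  by rewrite mulrC ltr_pM2r.
rewrite -ltr_pdivrMl// mulrC; apply: (lt_le_trans NC).
by rewrite ler_nat ltnW.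
Qed.

End fekete.

(** * Shift-invariant weights on words *)

Section invariant_weights.
Variable R : realType.
Implicit Types (m : seq bool -> R) (f : seq bool -> R).

(** The cylinder masses of a shift-invariant probability measure: extension on the right is
    Kolmogorov consistency, extension on the left is invariance. *)
Definition invariant_weight m :=
  [/\ m [::] = 1, forall w, 0 <= m w,
      forall w, \sum_(a : bool) m (rcons w a) = m w &
      forall w, \sum_(a : bool) m (a :: w) = m w].

Definition word_mean m f n : R := \sum_(w : n.-tuple bool) m w * f w.

Definition word_entropy m n : R := - word_mean m (fun w => ln (m w)) n.

Lemma word_meanM m f c n : word_mean m (fun w => c * f w) n = c * word_mean m f n.
Proof. by rewrite /word_mean mulr_sumr; apply: eq_bigr => w _; rewrite mulrCA. Qed.

Variable m : seq bool -> R.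
Hypothesis mP : invariant_weight m.

Let m1 : m [::] = 1. Proof. by case: mP. Qed.
Let m0 w : 0 <= m w. Proof. by case: mP. Qed.

Lemma weight_catr k w : \sum_(v : k.-tuple bool) m (w ++ v) = m w.
Proof.
case: mP => _ _ mr _; elim: k w => [|k IH] w.
  by rewrite (sum_word0 (fun v => m (w ++ v))) cats0.
rewrite (sum_wordS _ (fun v => m (w ++ v))) -[RHS]mr; apply: eq_bigr => a _.
by rewrite -(IH (rcons w a)); apply: eq_bigr => v _; rewrite cat_rcons.
Qed.

Lemma weight_catl k w : \sum_(v : k.-tuple bool) m (v ++ w) = m w.
Proof.
case: mP => _ _ _ ml; elim: k w => [|k IH] w.
  by rewrite (sum_word0 (fun v => m (v ++ w))).
rewrite (sum_wordSr _ (fun v => m (v ++ w))) exchange_big -[RHS]ml.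
apply: eq_bigr => a _; rewrite -(IH (a :: w)).
by apply: eq_bigr => v _; rewrite cat_rcons.
Qed.

Lemma weight_sum1 n : \sum_(w : n.-tuple bool) m w = 1.
Proof. by rewrite -m1 -(weight_catr n). Qed.

Lemma weight_cat_le w v : m (w ++ v) <= m w.
Proof.
rewrite -(weight_catr (size v) w) (bigD1 (in_tuple v))//= lerDl.
by rewrite sumr_ge0.
Qed.

Lemma weight_cat_ler w v : m (w ++ v) <= m v.
Proof.
rewrite -(weight_catl (size w) v) (bigD1 (in_tuple w))//= lerDl.
by rewrite sumr_ge0.
Qed.

Lemma weight_le1 w : m w <= 1.
Proof. by rewrite -m1 -{1}(cat0s w); exact: weight_cat_le. Qed.

Lemma word_mean_ge0 f n : (forall w, 0 <= f w) -> 0 <= word_mean m f n.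
Proof. by move=> f0; apply: sumr_ge0 => w _; rewrite mulr_ge0. Qed.

Lemma word_mean_cat f g h n k :
  (forall w v, h (w ++ v) <= f w + g v) ->
  word_mean m h (n + k) <= word_mean m f n + word_mean m g k.
Proof.
move=> hfg; rewrite /word_mean (sum_wordD n k (fun w => m w * h w)).
have -> : \sum_(w : n.-tuple bool) m w * f w =
    \sum_(w : n.-tuple bool) \sum_(v : k.-tuple bool) m (w ++ v) * f w.
  by apply: eq_bigr => w _; rewrite -mulr_suml weight_catr.
have -> : \sum_(v : k.-tuple bool) m v * g v =
    \sum_(w : n.-tuple bool) \sum_(v : k.-tuple bool) m (w ++ v) * g v.
  by rewrite exchange_big; apply: eq_bigr => w _; rewrite -mulr_suml weight_catl.
rewrite -big_split; apply: ler_sum => w _; rewrite -big_split; apply: ler_sum => v _ /=.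
by rewrite -mulrDr ler_wpM2l.
Qed.

Lemma word_entropy_ge0 n : 0 <= word_entropy m n.
Proof.
rewrite /word_entropy oppr_ge0; apply: sumr_le0 => w _.
by rewrite mulr_ge0_le0// ln_le0// weight_le1.
Qed.

(** Gibbs' inequality for the law of the concatenation against the product of its marginals; the
    second marginal is again [m] because of left consistency. *)
Lemma word_entropyD n k : word_entropy m (n + k) <= word_entropy m n + word_entropy m k.
Proof.
rewrite /word_entropy /word_mean.
rewrite -!sumrN (sum_wordD n k (fun w => - (m w * ln (m w)))).
have -> : \sum_(w : n.-tuple bool) - (m w * ln (m w)) =
    \sum_(w : n.-tuple bool) \sum_(v : k.-tuple bool) - (m (w ++ v) * ln (m w)).
  by apply: eq_bigr => w _; rewrite sumrN -mulr_suml weight_catr.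
have -> : \sum_(v : k.-tuple bool) - (m v * ln (m v)) =
    \sum_(w : n.-tuple bool) \sum_(v : k.-tuple bool) - (m (w ++ v) * ln (m v)).
  by rewrite exchange_big; apply: eq_bigr => w _; rewrite sumrN -mulr_suml weight_catl.
rewrite -big_split /= [leRHS](eq_bigr (fun w : n.-tuple bool => \sum_(v : k.-tuple bool)
   - (m (w ++ v) * ln (m w * m v)))); last first.
  move=> w _; rewrite -big_split; apply: eq_bigr => v _ /=.
  have := m0 (w ++ v); rewrite le_eqVlt => /predU1P[<-|wv0].
    by rewrite !mul0r oppr0 addr0.
  have w0 := lt_le_trans wv0 (weight_cat_le w v).
  have v0 := lt_le_trans wv0 (weight_cat_ler w v).
  by rewrite lnM ?posrE//; ring.
rewrite !pair_bigA !sumrN /=.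
apply: (@gibbs_inequality _ _ (fun p : n.-tuple bool * k.-tuple bool => m (p.1 ++ p.2))
  (fun p => m p.1 * m p.2)) => [p|p|p|].
- exact: m0.
- by rewrite mulr_ge0.
- move/eqP; rewrite mulf_eq0 => /orP[]/eqP e; apply/eqP; rewrite eq_le m0 andbT -{1}e.
    exact: weight_cat_le.
  exact: weight_cat_ler.
- rewrite -(pair_bigA _ (fun (w : n.-tuple bool) (v : k.-tuple bool) => m w * m v)).
  rewrite -(pair_bigA _ (fun (w : n.-tuple bool) (v : k.-tuple bool) => m (w ++ v))) /=.
  by rewrite -(sum_wordD n k m) weight_sum1 -big_distrlr/= !weight_sum1 mul1r.
Qed.

Lemma word_mean_sqr f n : word_mean m f n ^+ 2 <= word_mean m (fun w => f w ^+ 2) n.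
Proof.
set c := word_mean m f n.
have : 0 <= \sum_(w : n.-tuple bool) m w * (f w - c) ^+ 2.
  by apply: sumr_ge0 => w _; rewrite mulr_ge0// sqr_ge0.
rewrite (eq_bigr (fun w : n.-tuple bool =>
  m w * f w ^+ 2 + (- (2 * c) * (m w * f w) + c ^+ 2 * m w))); last first.
  by move=> w _; ring.
rewrite !big_split/= -!mulr_sumr weight_sum1 mulr1.
rewrite -/(word_mean m f n) -/c -/(word_mean m (fun w => f w ^+ 2) n) => h.
by rewrite -subr_ge0; apply: le_trans h _; rewrite le_eqVlt; apply/orP; left; apply/eqP; ring.
Qed.

End invariant_weights.

(** * Birkhoff sums along a word and the states that it drives *)

Section birkhoff_sums.
Variables (R : realType) (Z : Type) (step : Z -> bool -> Z).
Implicit Types (f : Z -> seq bool -> R).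

Fixpoint birkhoff f n z w : R :=
  if n is n'.+1 then f z w + birkhoff f n' (step z (head false w)) (behead w) else 0.

Definition depends_on_first j (f : seq bool -> R) :=
  forall w v, (j <= size w)%N -> f (w ++ v) = f w.

Lemma birkhoff_le f K n z w : (forall z w, `|f z w| <= K) ->
  `|birkhoff f n z w| <= n%:R * K.
Proof.
move=> fK; elim: n z w => [|n IH] z w /=; first by rewrite normr0 mul0r.
by rewrite -nat1r mulrDl mul1r; apply: (le_trans (ler_normD _ _)); apply: lerD.
Qed.

Lemma word_mean_birkhoff m (g : seq bool -> R) j n z : invariant_weight m ->
  depends_on_first j g ->
  word_mean m (birkhoff (fun=> g) n z) (n + j) = n%:R * word_mean m g j.
Proof.
move=> mP gj; have [_ _ _ ml] := mP.
have gz k z1 z2 w : birkhoff (fun=> g) k z1 w = birkhoff (fun=> g) k z2 w.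
  by elim: k z1 z2 w => //= k IH z1 z2 w; congr (_ + _); apply: IH.
rewrite /word_mean; elim: n z => [|n IH] z /=.
  by rewrite mul0r big1// => w _; rewrite mulr0.
rewrite (eq_bigr (fun w : (n.+1 + j).-tuple bool => m w * g w +
   m w * birkhoff (fun=> g) n (step z (head false w)) (behead w))); last first.
  by move=> w _; rewrite mulrDr.
rewrite big_split/= -nat1r mulrDl mul1r; congr (_ + _).
  rewrite [(n.+1 + j)%N]addnC (sum_wordD j n.+1 (fun w => m w * g w)).
  apply: eq_bigr => w _; rewrite -(weight_catr mP n.+1) mulr_suml.
  by apply: eq_bigr => v _; rewrite gj// size_tuple.
rewrite (sum_wordS _ (fun w => m w * birkhoff _ n (step z (head false w)) (behead w))) /=.
rewrite -(IH z) exchange_big; apply: eq_bigr => w _ /=.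
rewrite -ml mulr_suml; apply: eq_bigr => a _; congr (_ * _).
by apply: gz.
Qed.

End birkhoff_sums.

(** * The weighted 4-cycle and its Gibbs weight *)

Lemma sum_bool (V : nmodType) (F : bool -> V) : \sum_(a : bool) F a = F true + F false.
Proof. by rewrite big_bool. Qed.

Section chain.
Variables (R : realType) (u v : R).
Hypotheses (u1 : 1 < u) (v1 : 1 < v).

Definition step (z : bool * bool) (a : bool) : bool * bool :=
  if a then (~~ z.1, z.2) else (z.1, ~~ z.2).

(** In state [z] the row [z.1] of the A-product and the row [z.2] of the B-product are followed.
    Symbol 2 swaps the coordinates for A and symbol 1 does so for B; [u] and [v] stand for the
    diagonal entries 2 raised to the two exponents. *)
Definition letter_weight (z : bool * bool) (a : bool) : R :=
  if a then (if z.2 then v else 1) else (if z.1 then 1 else u).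

Fixpoint path_weight z w : R :=
  if w is a :: w' then letter_weight z a * path_weight (step z a) w' else 1.

(* The square of the spectral radius of the weighted 4-cycle: the larger root of
   [L ^+ 2 - (2 + u ^+ 2 + v ^+ 2) * L + (u - v) ^+ 2]. *)
Definition growth2 : R :=
  (2 + u ^+ 2 + v ^+ 2 + Num.sqrt ((2 + u ^+ 2 + v ^+ 2) ^+ 2 - 4 * (u - v) ^+ 2)) / 2.

Definition growth : R := Num.sqrt growth2.

(* The eigenvector of the weighted 4-cycle for the eigenvalue [growth]. *)
Definition perron (z : bool * bool) : R :=
  match z with
  | (true, false) => u + v
  | (false, true) => growth2 - 2
  | (false, false) => (u * (growth2 - 2) + (u + v)) / growth
  | (true, true) => (v * (growth2 - 2) + (u + v)) / growth
  end.

Let u0 : 0 < u. Proof. exact: lt_trans u1. Qed.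
Let v0 : 0 < v. Proof. exact: lt_trans v1. Qed.

Lemma sum_state (V : nmodType) (F : bool * bool -> V) :
  \sum_z F z = F (true, true) + F (true, false) + (F (false, true) + F (false, false)).
Proof.
rewrite (eq_bigr (fun p => F (p.1, p.2))); last by case.
by rewrite -(pair_bigA _ (fun s t => F (s, t))) /= !sum_bool.
Qed.

Lemma growth2_eq : growth2 ^+ 2 = (2 + u ^+ 2 + v ^+ 2) * growth2 - (u - v) ^+ 2.
Proof.
rewrite /growth2.
have h : 0 <= (2 + u ^+ 2 + v ^+ 2) ^+ 2 - 4 * (u - v) ^+ 2.
  have -> : (2 + u ^+ 2 + v ^+ 2) ^+ 2 - 4 * (u - v) ^+ 2 =
    (2 + u ^+ 2 + v ^+ 2 - 2 * (u - v)) * (2 + u ^+ 2 + v ^+ 2 + 2 * (u - v)) by ring.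
  apply: mulr_ge0.
    have -> : 2 + u ^+ 2 + v ^+ 2 - 2 * (u - v) = (u - 1) ^+ 2 + (v + 1) ^+ 2 by ring.
    by rewrite addr_ge0 ?sqr_ge0.
  have -> : 2 + u ^+ 2 + v ^+ 2 + 2 * (u - v) = (u + 1) ^+ 2 + (v - 1) ^+ 2 by ring.
  by rewrite addr_ge0 ?sqr_ge0.
have := sqr_sqrtr h; set s := Num.sqrt _ => hs.
have -> : ((2 + u ^+ 2 + v ^+ 2 + s) / 2) ^+ 2 =
  ((2 + u ^+ 2 + v ^+ 2) ^+ 2 + 2 * s * (2 + u ^+ 2 + v ^+ 2) + s ^+ 2) / 4 by field.
by rewrite hs; field.
Qed.

Lemma growth2_gt2 : 2 < growth2.
Proof.
have uu : 1 < u ^+ 2 by rewrite exprn_egt1.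
have vv : 1 < v ^+ 2 by rewrite exprn_egt1.
have s0 := sqrtr_ge0 ((2 + u ^+ 2 + v ^+ 2) ^+ 2 - 4 * (u - v) ^+ 2).
by rewrite /growth2; lra.
Qed.

Lemma growth_gt0 : 0 < growth.
Proof. by rewrite sqrtr_gt0 (lt_trans _ growth2_gt2). Qed.

Let lam_neq0 : growth != 0. Proof. by rewrite gt_eqF ?growth_gt0. Qed.

Lemma growth_sqr : growth ^+ 2 = growth2.
Proof. by rewrite sqr_sqrtr// ltW// (lt_trans _ growth2_gt2). Qed.

Lemma perron_gt0 z : 0 < perron z.
Proof.
have uv : 0 < u + v by exact: addr_gt0.
have c : 0 < growth2 - 2 by have := growth2_gt2; rewrite subr_gt0.
case: z => [[] []] //=; rewrite divr_gt0 ?growth_gt0//.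
  by rewrite addr_gt0// mulr_gt0.
by rewrite addr_gt0// mulr_gt0.
Qed.

Lemma letter_weight_gt0 z a : 0 < letter_weight z a.
Proof. by rewrite /letter_weight; case: a; case: ifP. Qed.

Lemma path_weight_gt0 z w : 0 < path_weight z w.
Proof. by elim: w z => //= a w IH z; rewrite mulr_gt0 ?letter_weight_gt0. Qed.

Lemma perron_eigen z :
  \sum_(a : bool) letter_weight z a * perron (step z a) = growth * perron z.
Proof.
rewrite sum_bool /=; have e := growth2_eq.
case: z => [[] []] /=; rewrite /letter_weight/=.
- by rewrite mul1r; field.
- rewrite !mul1r -mulrDl; apply: (mulIf lam_neq0); rewrite mulfVK//.
  rewrite (_ : _ * growth = growth ^+ 2 * (u + v)); last by ring.
  by rewrite growth_sqr; ring.
(* Only the state [(false, true)] needs the quadratic equation: two of the other equations define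
   [perron], and the third is an identity once [growth ^+ 2] is replaced by [growth2]. *)
- rewrite !mulrA -mulrDl; apply: (mulIf lam_neq0); rewrite mulfVK//.
  rewrite (_ : _ * growth = growth ^+ 2 * (growth2 - 2)); last by ring.
  rewrite growth_sqr (_ : growth2 * _ = growth2 ^+ 2 - 2 * growth2); last by ring.
  by rewrite e; ring.
- by field.
Qed.

Lemma stepK a z : step (step z a) a = z.
Proof. by case: a z => [] [[] []]. Qed.

(** The cycle is undirected, so the matrix of each letter is symmetric. This makes [perron] a left
    eigenvector too, which gives the left consistency of [gibbs_weight] and the stationarity of
    [perron z ^+ 2 / mass]. *)
Lemma letter_weight_step z a : letter_weight (step z a) a = letter_weight z a.
Proof. by case: a. Qed.

Lemma sum_step (V : nmodType) a (F : bool * bool -> V) : \sum_z F (step z a) = \sum_z F z.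
Proof.
rewrite [RHS](reindex_inj (h := step^~ a))//.
exact: (can_inj (g := step^~ a) (stepK a)).
Qed.

Definition mass : R := \sum_z perron z ^+ 2.

Lemma mass_gt0 : 0 < mass.
Proof.
by rewrite /mass sum_state !addr_gt0// exprn_gt0// perron_gt0.
Qed.

Definition gibbs_weight (w : seq bool) : R :=
  (\sum_z perron z * path_weight z w * perron (foldl step z w))
    / (mass * growth ^+ size w).

Lemma path_weight_rcons z w a :
  path_weight z (rcons w a) = path_weight z w * letter_weight (foldl step z w) a.
Proof. by elim: w z => [|b w IH] z /=; rewrite ?mul1r ?mulr1// IH mulrA. Qed.

Lemma gibbs_weightP : invariant_weight gibbs_weight.
Proof.
have m0 := mass_gt0; have l0 := growth_gt0.
split.
- rewrite /gibbs_weight /= expr0 mulr1 (eq_bigr (fun z => perron z ^+ 2)).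
    by rewrite divff// gt_eqF.
  by move=> z _; rewrite mulr1 expr2.
- move=> w; rewrite /gibbs_weight divr_ge0//.
    by apply: sumr_ge0 => z _; rewrite !mulr_ge0 ?ltW ?perron_gt0 ?path_weight_gt0.
  by rewrite mulr_ge0 ?ltW// exprn_gt0.
- move=> w; rewrite /gibbs_weight.
  under eq_bigr do rewrite size_rcons.
  rewrite -mulr_suml exchange_big /= exprS.
  rewrite (eq_bigr (fun z => growth * (perron z * path_weight z w * perron (foldl step z w)))).
    by rewrite -mulr_sumr; field; rewrite ?lam_neq0 ?gt_eqF ?exprn_gt0.
  move=> z _; rewrite mulrCA -perron_eigen mulr_sumr; apply: eq_bigr => a _.
  by rewrite path_weight_rcons foldl_rcons; ring.
- move=> w; rewrite /gibbs_weight /= -mulr_suml exprS.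
  have -> : \sum_a \sum_z perron z * (letter_weight z a * path_weight (step z a) w)
      * perron (foldl step (step z a) w) =
      growth * \sum_z (perron z * path_weight z w * perron (foldl step z w)).
    rewrite mulr_sumr [RHS](eq_bigr (fun z => \sum_a perron (step z a) *
       (letter_weight (step z a) a * path_weight z w) * perron (foldl step z w))).
      rewrite [RHS]exchange_big; apply: eq_bigr => a _ /=.
      rewrite -[RHS](sum_step a); apply: eq_bigr => z _.
      by rewrite stepK.
    move=> z _; rewrite !mulrA -perron_eigen !mulr_suml; apply: eq_bigr => a _.
    by rewrite letter_weight_step; ring.
  by field; rewrite ?lam_neq0 ?gt_eqF ?exprn_gt0.
Qed.

(* Doob transform of the letter weights by the eigenvector. *)
Definition trans (z : bool * bool) (a : bool) : R :=
  letter_weight z a * perron (step z a) / (growth * perron z).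

Fixpoint chain_mean n z (f : seq bool -> R) : R :=
  if n is n'.+1 then
    \sum_(a : bool) trans z a * chain_mean n' (step z a) (fun w => f (a :: w))
  else f [::].

Lemma trans_ge0 z a : 0 <= trans z a.
Proof.
by rewrite /trans divr_ge0// mulr_ge0 ?ltW ?letter_weight_gt0 ?perron_gt0 ?growth_gt0.
Qed.

Lemma trans_sum1 z : \sum_(a : bool) trans z a = 1.
Proof.
by rewrite -mulr_suml perron_eigen divff// mulf_neq0// gt_eqF ?perron_gt0 ?growth_gt0.
Qed.

Lemma chain_mean_ext n z f g : f =1 g -> chain_mean n z f = chain_mean n z g.
Proof.
elim: n z f g => [|n IH] z f g fg /=; first exact: fg.
by apply: eq_bigr => a _; congr (_ * _); apply: IH => w; apply: fg.
Qed.

Lemma chain_mean_sum n z f : chain_mean n z f = \sum_(w : n.-tuple bool)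
  path_weight z w * perron (foldl step z w) / (growth ^+ n * perron z) * f w.
Proof.
elim: n z f => [|n IH] z f /=.
  rewrite (sum_word0 (fun w => path_weight z w * perron (foldl step z w)
    / (growth ^+ 0 * perron z) * f w)) /= !mul1r divff ?mul1r//.
  by rewrite gt_eqF ?perron_gt0.
rewrite (sum_wordS _ (fun w => path_weight z w * perron (foldl step z w)
    / (growth ^+ n.+1 * perron z) * f w)) /=; apply: eq_bigr => a _.
rewrite IH mulr_sumr; apply: eq_bigr => w _; rewrite /trans exprS; field.
by rewrite lam_neq0 !expf_neq0// !gt_eqF ?perron_gt0.
Qed.

Definition stationary_mean (F : bool * bool -> R) : R :=
  (\sum_z perron z ^+ 2 * F z) / mass.

(** [gibbs_weight] is the law of the letters read along the stationary Doob chain: the ratios of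
    [perron] telescope along a path and leave only its two ends. *)
Lemma word_mean_gibbs_weight f n : word_mean gibbs_weight f n =
  stationary_mean (fun z => chain_mean n z f).
Proof.
rewrite /word_mean /stationary_mean /gibbs_weight.
move: mass mass_gt0 => M M0.
under eq_bigr do rewrite size_tuple mulrAC mulr_suml.
rewrite -mulr_suml exchange_big /= [LHS]mulr_suml [RHS]mulr_suml.
apply: eq_bigr => z _; rewrite chain_mean_sum mulr_sumr !mulr_suml.
apply: eq_bigr => w _; field.
by rewrite expf_neq0// !gt_eqF ?perron_gt0.
Qed.

Lemma stationary_mean_trans F :
  stationary_mean (fun z => \sum_(a : bool) trans z a * F (step z a)) = stationary_mean F.
Proof.
rewrite /stationary_mean; congr (_ / _).
rewrite (eq_bigr (fun z => \sum_a growth^-1 * (perron z * letter_weight z a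
    * perron (step z a) * F (step z a)))); last first.
  move=> z _; rewrite mulr_sumr; apply: eq_bigr => a _; rewrite /trans; field.
  by rewrite lam_neq0 gt_eqF ?perron_gt0.
rewrite exchange_big /=.
rewrite (eq_bigr (fun a => growth^-1 * \sum_z perron z * F z *
    (letter_weight z a * perron (step z a)))); last first.
  move=> a _; rewrite -mulr_sumr -[in RHS](sum_step a); congr (_ * _).
  apply: eq_bigr => z _.
  by rewrite stepK letter_weight_step; ring.
rewrite -mulr_sumr exchange_big mulr_sumr; apply: eq_bigr => z _ /=.
by rewrite -mulr_sumr perron_eigen; field.
Qed.

Lemma stationary_mean_le F G : (forall z, F z <= G z) ->
  stationary_mean F <= stationary_mean G.
Proof.
move=> FG; apply: ler_wpM2r; first by rewrite invr_ge0 ltW// mass_gt0.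
by apply: ler_sum => z _; rewrite ler_wpM2l// sqr_ge0.
Qed.

Lemma stationary_mean_cst c : stationary_mean (fun=> c) = c.
Proof.
by rewrite /stationary_mean -mulr_suml mulrAC divff ?mul1r// gt_eqF ?mass_gt0.
Qed.

Lemma stationary_meanD F G :
  stationary_mean (fun z => F z + G z) = stationary_mean F + stationary_mean G.
Proof.
rewrite /stationary_mean -mulrDl -big_split; congr (_ / _).
by apply: eq_bigr => z _; rewrite mulrDr.
Qed.

(** Irreducibility makes the range of the identity minus the transition operator equal to the kernel
    of the stationary law; aperiodicity does not enter. With four states the solution can be written
    down. *)
Lemma poisson_equation (g : bool * bool -> R) : stationary_mean g = 0 ->
  exists psi : bool * bool -> R,
    forall z, g z = psi z - \sum_(a : bool) trans z a * psi (step z a).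
Proof.
move=> gm.
have hN z : perron z != 0 by rewrite gt_eqF ?perron_gt0.
have {gm} : \sum_z perron z * (perron z * g z) = 0.
  move/eqP: gm; rewrite /stationary_mean mulf_eq0 invr_eq0 [mass == 0]gt_eqF ?mass_gt0// orbF.
  by move/eqP => e; rewrite -[RHS]e; apply: eq_bigr => z _; rewrite mulrA -expr2.
(* Multiplication by [perron] undoes the Doob transform: for [Psi z = perron z * psi z] the equation
   involves only the symmetric letter weights. *)
pose G z := perron z * g z.
suff H : \sum_z perron z * G z = 0 -> exists Psi : bool * bool -> R, forall z,
    growth * G z = growth * Psi z - \sum_(a : bool) letter_weight z a * Psi (step z a).
  move=> /H[Psi HPsi]; exists (fun z => Psi z / perron z) => z.
  have := HPsi z; rewrite !sum_bool /G /trans => e.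
  apply: (mulfI lam_neq0); apply: (mulfI (hN z)); rewrite mulrCA e; field.
  by rewrite lam_neq0 !hN.
rewrite sum_state => Gm.
have uv0 : u + v != 0 by rewrite gt_eqF// addr_gt0.
(* With value 0 at [(true, false)], the equations at all states but
   [(false, true)] determine the solution; the remaining one follows from
   the orthogonality of [G] to [perron]. *)
pose pc := - growth * (growth * G (true, false) + G (false, false) + G (true, true)) / (u + v).
exists (fun z => match z with
  | (true, false) => 0
  | (false, true) => pc
  | (false, false) => G (false, false) + u * pc / growth
  | (true, true) => G (true, true) + v * pc / growth
  end) => z.
have ec := perron_eigen (false, true).
have ea := perron_eigen (true, false).
have eb := perron_eigen (false, false).
have ed := perron_eigen (true, true).
move: ea eb ec ed; rewrite sum_bool.
case: z => [[] []] /=; rewrite !sum_bool /letter_weight /step /= => ea eb ec ed.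
- by field; rewrite lam_neq0.
- by rewrite /pc; field; rewrite lam_neq0 uv0.
- apply: (mulfI (hN (false, true))).
  have -> : perron (false, true) * (growth * G (false, true)) = growth *
    - (perron (true, true) * G (true, true) + perron (true, false) * G (true, false)
       + perron (false, false) * G (false, false)).
    by rewrite mulrCA; congr (_ * _); apply/eqP; rewrite -subr_eq0 opprK -[eqbRHS]Gm; apply/eqP; ring.
  (* The quadratic equation of [growth2], read as the eigenvector equation at [(false, true)]
     cleared of denominators. *)
  have key : (growth ^+ 2 - (u ^+ 2 + v ^+ 2)) * (growth2 - 2) = (u + v) ^+ 2.
    rewrite growth_sqr; apply/eqP; rewrite -subr_eq0; apply/eqP.
    transitivity (growth2 ^+ 2 - ((2 + u ^+ 2 + v ^+ 2) * growth2 - (u - v) ^+ 2)); first by ring.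
    by rewrite growth2_eq subrr.
  have -> : perron (false, true) * (growth * pc - (v * (G (true, true) + v * pc / growth)
      + u * (G (false, false) + u * pc / growth))) =
      pc / growth * ((growth ^+ 2 - (u ^+ 2 + v ^+ 2)) * (growth2 - 2))
      - (u * G (false, false) + v * G (true, true)) * (growth2 - 2).
    by rewrite /=; field.
  by rewrite key /pc /=; field; rewrite lam_neq0 uv0.
- by field; rewrite lam_neq0.
Qed.

End chain.

(** * Variance of Birkhoff sums *)

Section variance.
Variables (R : realType) (u v : R).
Hypotheses (u1 : 1 < u) (v1 : 1 < v).
Local Notation trans := (trans u v).
Local Notation chain_mean := (chain_mean u v).
Local Notation stationary_mean := (stationary_mean u v).
Local Notation birkhoff := (birkhoff step).

Lemma chain_meanD n z f g :
  chain_mean n z (fun w => f w + g w) = chain_mean n z f + chain_mean n z g.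
Proof.
elim: n z f g => [//|n IH] z f g /=.
by rewrite -big_split; apply: eq_bigr => a _ /=; rewrite -mulrDr IH.
Qed.

Lemma chain_meanM n z c f : chain_mean n z (fun w => c * f w) = c * chain_mean n z f.
Proof.
elim: n z f => [//|n IH] z f /=.
by rewrite mulr_sumr; apply: eq_bigr => a _; rewrite mulrCA IH.
Qed.

Lemma chain_mean_cst n z c : chain_mean n z (fun=> c) = c.
Proof.
elim: n z => [//|n IH] z /=; under eq_bigr do rewrite IH.
by rewrite -mulr_suml trans_sum1 ?mul1r.
Qed.

Lemma chain_mean_le n z f g : (forall w, f w <= g w) -> chain_mean n z f <= chain_mean n z g.
Proof.
elim: n z f g => [|n IH] z f g fg /=; first exact: fg.
by apply: ler_sum => a _; rewrite ler_wpM2l ?trans_ge0 ?IH.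
Qed.

Lemma chain_mean_norm n z f K : (forall w, `|f w| <= K) -> `|chain_mean n z f| <= K.
Proof.
move=> fK; rewrite ler_norml; apply/andP; split.
  rewrite -(chain_mean_cst n z (- K)); apply: chain_mean_le => w.
  by have := fK w; rewrite ler_norml => /andP[].
rewrite -[leRHS](chain_mean_cst n z); apply: chain_mean_le => w.
by have := fK w; rewrite ler_norml => /andP[].
Qed.

Lemma trans_norm z (F : bool -> R) K : (forall a, `|F a| <= K) ->
  `|\sum_(a : bool) trans z a * F a| <= K.
Proof.
move=> FK; apply: (le_trans (ler_norm_sum _ _ _)).
rewrite -[K]mul1r -(trans_sum1 u1 v1 z) mulr_suml; apply: ler_sum => a _.
by rewrite normrM ger0_norm ?trans_ge0// ler_wpM2l ?trans_ge0.
Qed.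

Lemma chain_mean_first j k z f : depends_on_first j f ->
  chain_mean (j + k) z f = chain_mean j z f.
Proof.
elim: j z f => [|j IH] z f fj.
  rewrite add0n -[RHS](chain_mean_cst k z); apply: chain_mean_ext => w.
  by rewrite /= -(fj [::] w).
by apply: eq_bigr => a _; congr (_ * _); apply: IH => w w' jw; exact: (fj (a :: w) w').
Qed.

Section mixing.
Variables (f : bool * bool -> seq bool -> R) (j : nat) (K : R).
Hypotheses (fj : forall z, depends_on_first j (f z)) (fK : forall z w, `|f z w| <= K).
Hypothesis f0 : stationary_mean (fun z => chain_mean j z (f z)) = 0.

(** With [psi] from the Poisson equation the expected sum telescopes to [psi z] minus the
    expectation of [psi] at the final state, so it is bounded although individual terms need not
    tend to 0. *)
Lemma birkhoff_mean_bounded :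
  exists B, forall n z, `|chain_mean (n + j) z (birkhoff f n z)| <= B.
Proof.
have [psi Hpsi] := poisson_equation u1 v1 f0.
pose D := \sum_z `|psi z|.
have psiD z : `|psi z| <= D by rewrite /D (bigD1 z)//= lerDl sumr_ge0.
suff H n z : `|chain_mean (n + j) z (birkhoff f n z) - psi z| <= D.
  exists (D + D) => n z; rewrite -(subrK (psi z) (chain_mean _ _ _)).
  by apply: (le_trans (ler_normD _ _)); rewrite lerD.
elim: n z => [|n IH] z.
  by rewrite chain_mean_cst sub0r normrN.
have -> : chain_mean (n.+1 + j) z (birkhoff f n.+1 z) = chain_mean j z (f z) +
    \sum_(a : bool) trans z a * chain_mean (n + j) (step z a) (birkhoff f n (step z a)).
  have -> : chain_mean j z (f z) = chain_mean (n.+1 + j) z (f z).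
    by rewrite addnC chain_mean_first.
  by rewrite -[RHS](chain_meanD (n.+1 + j) z (f z) (fun w =>
    birkhoff f n (step z (head false w)) (behead w))).
rewrite Hpsi [psi z - _]addrC addrAC addrK addrC -sumrB.
by under eq_bigr do rewrite -mulrBr; apply: trans_norm => a; apply: IH.
Qed.

(** Once the [i] letters seen by [g] are read, the rest of the sum has conditional mean at most [B];
    each of the first [i] terms costs at most [K]. The induction on [i] peels off one letter at a
    time. *)
Lemma birkhoff_cross_bounded : exists2 B, 0 <= B & forall i n z (g : seq bool -> R) C,
  0 <= C -> depends_on_first i g -> (forall w, `|g w| <= C) ->
  `|chain_mean (n + j) z (fun w => g w * birkhoff f n z w)| <= C * (B + i%:R * K).
Proof.
have [B HB] := birkhoff_mean_bounded.
have B0 : 0 <= B by apply: le_trans (HB 0%N (true, true)).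
have K0 : 0 <= K by apply: le_trans (fK (true, true) [::]).
exists B => // i n z g C C0; elim: i n z g => [|i IH] n z g gi gC.
  rewrite mul0r addr0 (@chain_mean_ext _ _ _ _ _ _ (fun w => g [::] * birkhoff f n z w)).
    by rewrite chain_meanM normrM ler_pM.
  by move=> w; rewrite -(gi [::] w).
case: n => [|n].
  rewrite (@chain_mean_ext _ _ _ _ _ _ (fun=> 0)) => [|w]; last by rewrite mulr0.
  by rewrite chain_mean_cst normr0 mulr_ge0// addr_ge0// mulr_ge0.
rewrite (@chain_mean_ext _ _ _ _ _ _ (fun w => g w * f z w +
  g w * birkhoff f n (step z (head false w)) (behead w))) => [|w]; last by rewrite -mulrDr.
rewrite chain_meanD -[i.+1]addn1 natrD mulrDl mul1r addrA mulrDr [in leLHS]addrC.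
apply: (le_trans (ler_normD _ _)); apply: lerD.
  apply: trans_norm => a.
  apply: (IH n (step z a) (fun w => g (a :: w))) => [w w' iw|w]; last exact: gC.
  exact: (gi (a :: w) w').
by apply: chain_mean_norm => w; rewrite normrM ler_pM.
Qed.

(** The square of the first term plus the remaining sum [S] is expanded: the square of the first
    term and the cross term are bounded, and the mean of [S ^+ 2] is the previous one by
    stationarity. So each step adds at most a constant. *)
Lemma birkhoff_variance : exists2 C, 0 <= C & forall n,
  stationary_mean (fun z => chain_mean (n + j) z (fun w => birkhoff f n z w ^+ 2)) <= n%:R * C.
Proof.
have [B B0 HB] := birkhoff_cross_bounded.
have K0 : 0 <= K by apply: le_trans (fK (true, true) [::]).
have D0 : 0 <= K * (B + j%:R * K) by rewrite mulr_ge0// addr_ge0// mulr_ge0.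
exists (K ^+ 2 + 2 * (K * (B + j%:R * K))).
  by rewrite addr_ge0 ?sqr_ge0// mulr_ge0.
elim=> [|n IH].
  rewrite mul0r -[leRHS](stationary_mean_cst u1 v1 0); apply: stationary_mean_le => // z.
  by rewrite (@chain_mean_ext _ _ _ _ _ _ (fun=> 0)) ?chain_mean_cst// => w; rewrite expr0n.
pose S z w := birkhoff f n (step z (head false w)) (behead w).
rewrite -nat1r mulrDl mul1r.
apply: (@le_trans _ _ (stationary_mean (fun z => (K ^+ 2 + 2 * (K * (B + j%:R * K))) +
   \sum_(a : bool) trans z a * chain_mean (n + j) (step z a)
     (fun w => birkhoff f n (step z a) w ^+ 2)))).
  apply: stationary_mean_le => // z.
  rewrite (@chain_mean_ext _ _ _ _ _ _ (fun w => f z w ^+ 2 + (2 * (f z w * S z w)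
     + S z w ^+ 2))) => [|w]; last by rewrite /S /=; ring.
  rewrite !chain_meanD chain_meanM -addrA lerD//.
    apply: le_trans (ler_norm _) _; apply: chain_mean_norm => w.
    by rewrite normrX lerXn2r// nnegrE.
  rewrite lerD2r ler_wpM2l//; apply: le_trans (ler_norm _) _.
  apply: trans_norm => a; apply: HB => // w w' jw.
  by apply: (@fj z (a :: w) w') => /=; rewrite ltnW.
rewrite stationary_meanD stationary_mean_cst// lerD2l.
by rewrite (stationary_mean_trans u1 v1 (fun z => chain_mean (n + j) z
  (fun w => birkhoff f n z w ^+ 2))).
Qed.

End mixing.
End variance.

(** * Gibbs bounds and uniqueness *)

Lemma ln_ratio_bound (R : realType) (x y K : R) : 0 < x -> 0 < y ->
  expR (- K) * y <= x <= expR K * y -> `|ln x - ln y| <= K.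
Proof.
move=> x0 y0 /andP[h1 h2]; rewrite -ln_div ?posrE// ler_norml.
rewrite -[- K]expRK -[X in _ && (_ <= X)]expRK !ler_ln ?posrE ?expR_gt0 ?divr_gt0//.
by rewrite ler_pdivlMr// h1 ler_pdivrMr.
Qed.

Section gibbs_property.
Variables (R : realType) (u v : R).
Hypotheses (u1 : 1 < u) (v1 : 1 < v).
Variable Phi : seq bool -> R.
Hypothesis path_weight_le : forall z w, path_weight u v z w <= Phi w.
Hypothesis path_weight_max : forall w, exists z, Phi w = path_weight u v z w.
Local Notation gibbs_weight := (gibbs_weight u v).
Local Notation growth := (growth u v).
Local Notation perron := (perron u v).

Lemma path_weight_cat z w w' :
  path_weight u v z (w ++ w') = path_weight u v z w * path_weight u v (foldl step z w) w'.
Proof. by elim: w z => [|a w IH] z /=; rewrite ?mul1r// IH mulrA. Qed.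

Lemma path_weight_ge1 z w : 1 <= path_weight u v z w.
Proof.
elim: w z => [//|a w IH] z /=; rewrite -[leLHS]mulr1; apply: ler_pM => //.
by rewrite /letter_weight; case: a; case: ifP => _ //; apply: ltW.
Qed.

Lemma potential_ge1 w : 1 <= Phi w.
Proof. by have [z ->] := path_weight_max w; apply: path_weight_ge1. Qed.

Lemma potential_gt0 w : 0 < Phi w.
Proof. exact: lt_le_trans (potential_ge1 w). Qed.

Lemma ln_potential_cat w w' : ln (Phi (w ++ w')) <= ln (Phi w) + ln (Phi w').
Proof.
rewrite -lnM ?posrE ?potential_gt0// ler_ln ?posrE ?mulr_gt0 ?potential_gt0//.
have [z ->] := path_weight_max (w ++ w'); rewrite path_weight_cat.
by apply: ler_pM => //; apply: le_trans (path_weight_ge1 _ _).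
Qed.

(** [perron] lies between two positive constants. The lower bound keeps only a state of maximal path
    weight; the upper bound replaces all four path weights by the maximum, hence the 4 in [K2]. *)
Lemma gibbs_bounds : exists2 K, 0 <= K & forall w,
  expR (- K) * Phi w <= gibbs_weight w * growth ^+ size w <= expR K * Phi w.
Proof.
have h0 := perron_gt0 u1 v1; have m0 := mass_gt0 u1 v1; have g0 := growth_gt0 u1 v1.
pose b := \sum_z perron z.
pose a := (\sum_z (perron z)^-1)^-1.
have hb z : perron z <= b.
  by rewrite /b (bigD1 z)//= lerDl; apply: sumr_ge0 => i _; apply: ltW.
have a0 : 0 < a.
  by rewrite invr_gt0 sum_state !addr_gt0// invr_gt0.
have ah z : a <= perron z.
  rewrite -[leRHS]invrK lef_pV2 ?posrE ?invr_gt0//; last by rewrite -invr_gt0.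
  by rewrite (bigD1 z)//= lerDl; apply: sumr_ge0 => i _; rewrite invr_ge0 ltW.
have b0 : 0 < b by apply: lt_le_trans (hb (true, true)).
pose K1 := a ^+ 2 / mass u v; pose K2 := 4 * b ^+ 2 / mass u v.
have K10 : 0 < K1 by rewrite divr_gt0// exprn_gt0.
have K20 : 0 < K2 by rewrite divr_gt0// mulr_gt0// exprn_gt0.
exists (`|ln K1| + `|ln K2|) => // w.
have e : gibbs_weight w * growth ^+ size w =
    (\sum_z perron z * path_weight u v z w * perron (foldl step z w)) / mass u v.
  by rewrite /gibbs_weight; field; rewrite expf_neq0 ?gt_eqF.
have P0 := potential_gt0 w.
have p0 z := path_weight_gt0 u1 v1 z w.
rewrite e; apply/andP; split.
  apply: (@le_trans _ _ (K1 * Phi w)).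
    rewrite ler_pM2r// -[leRHS]lnK ?posrE// ler_expR.
    have := ler_norm (- ln K1); rewrite normrN; have := normr_ge0 (ln K2); lra.
  have [z ->] := path_weight_max w.
  rewrite /K1 mulrAC ler_pM2r ?invr_gt0// (bigD1 z)//=.
  rewrite -[leLHS]addr0 lerD//.
    rewrite expr2 mulrAC; apply: ler_pM => //; first by rewrite mulr_ge0 ?ltW.
      exact: ltW.
    by rewrite ler_pM2r.
  by apply: sumr_ge0 => i _; rewrite !mulr_ge0// ltW.
apply: (@le_trans _ _ (K2 * Phi w)); last first.
  rewrite ler_pM2r// -[leLHS]lnK ?posrE// ler_expR.
  by have := ler_norm (ln K2); have := normr_ge0 (ln K1); lra.
rewrite /K2 [leRHS]mulrAC ler_pM2r ?invr_gt0//.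
apply: (@le_trans _ _ (\sum_(z : bool * bool) b * Phi w * b)).
  apply: ler_sum => z _; apply: ler_pM => //; first by rewrite mulr_ge0 ?ltW.
    exact: ltW.
  by apply: ler_pM => //; apply: ltW.
by rewrite sum_state le_eqVlt; apply/orP; left; apply/eqP; ring.
Qed.

Lemma gibbs_weight_gt0 w : 0 < gibbs_weight w.
Proof.
have [K _ HK] := gibbs_bounds; have /andP[h _] := HK w.
have g0 := growth_gt0 u1 v1.
rewrite -(pmulr_lgt0 _ (exprn_gt0 (size w) g0)); apply: lt_le_trans h.
by rewrite mulr_gt0 ?expR_gt0 ?potential_gt0.
Qed.

Lemma ln_gibbs_bounds : exists2 K, 0 <= K & forall w,
  `|ln (gibbs_weight w) - ln (Phi w) + (size w)%:R * ln growth| <= K.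
Proof.
have [K K0 HK] := gibbs_bounds; exists K => // w.
have g0 := growth_gt0 u1 v1; have P0 := potential_gt0 w; have G0 := gibbs_weight_gt0 w.
have := ln_ratio_bound (mulr_gt0 G0 (exprn_gt0 _ g0)) P0 (HK w).
by rewrite lnM ?posrE ?exprn_gt0// lnXn// mulr_natl addrAC.
Qed.

Lemma potential_sum_bounds : exists2 K, 0 <= K & forall n,
  `|ln (\sum_(w : n.-tuple bool) Phi w) - n%:R * ln growth| <= K.
Proof.
have [K K0 HK] := gibbs_bounds; exists K => // n.
have g0 := growth_gt0 u1 v1.
pose S := \sum_(w : n.-tuple bool) Phi w.
have S0 : 0 < S.
  apply: (@lt_le_trans _ _ (Phi (nseq_tuple n true))); first exact: potential_gt0.
  by rewrite /S (bigD1 (nseq_tuple n true))//= lerDl sumr_ge0// => i _; rewrite ltW ?potential_gt0.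
have gS : \sum_(w : n.-tuple bool) gibbs_weight w * growth ^+ size w = growth ^+ n.
  rewrite (eq_bigr (fun w : n.-tuple bool => gibbs_weight w * growth ^+ n)).
    by rewrite -mulr_suml weight_sum1 ?mul1r//; apply: gibbs_weightP.
  by move=> w _; rewrite size_tuple.
have h1 : expR (- K) * S <= growth ^+ n.
  by rewrite -gS mulr_sumr; apply: ler_sum => w _; case/andP: (HK w).
have h2 : growth ^+ n <= expR K * S.
  by rewrite -gS mulr_sumr; apply: ler_sum => w _; case/andP: (HK w).
rewrite distrC mulr_natl -lnXn//; apply: ln_ratio_bound => //; first exact: exprn_gt0.
by rewrite h1.
Qed.

Lemma gibbs_free_energy : exists2 K, 0 <= K & forall n,
  `|word_entropy gibbs_weight n + word_mean gibbs_weight (fun w => ln (Phi w)) n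
     - n%:R * ln growth| <= K.
Proof.
have [K K0 HK] := ln_gibbs_bounds; exists K => // n.
have gP := gibbs_weightP u1 v1.
have -> : n%:R * ln growth = \sum_(w : n.-tuple bool) gibbs_weight w * (n%:R * ln growth).
  by rewrite -mulr_suml weight_sum1// mul1r.
rewrite /word_entropy /word_mean.
rewrite [X in `|X - _|]addrC -!sumrB; apply: le_trans (ler_norm_sum _ _ _) _.
rewrite -[leRHS]mul1r -[in leRHS](weight_sum1 gP n) mulr_suml; apply: ler_sum => w _.
have -> : gibbs_weight w * ln (Phi w) - gibbs_weight w * ln (gibbs_weight w) -
    gibbs_weight w * (n%:R * ln growth) = gibbs_weight w *
    - (ln (gibbs_weight w) - ln (Phi w) + (size w)%:R * ln growth).
  by rewrite size_tuple; ring.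
by rewrite normrM normrN gtr0_norm ?gibbs_weight_gt0// ler_pM2l ?gibbs_weight_gt0.
Qed.

Lemma prefix_depends_on_first (U : seq bool) (c : R) :
  depends_on_first (size U) (fun w => (prefix U w)%:R - c).
Proof.
move=> w w' Uw; congr (_%:R - _); rewrite !prefixE take_cat.
by case: ltngtP Uw => // ->; rewrite subnn take0 cats0 take_size.
Qed.

Lemma word_mean_prefix m (U : seq bool) (c : R) : invariant_weight m ->
  word_mean m (fun w => (prefix U w)%:R - c) (size U) = m U - c.
Proof.
move=> mP; rewrite /word_mean; under eq_bigr do rewrite mulrBr.
rewrite sumrB -mulr_suml weight_sum1// mul1r; congr (_ - _).
rewrite (bigD1 (in_tuple U))//= prefix_refl mulr1 big1 ?addr0// => w wU.
rewrite prefixE take_oversize ?size_tuple//.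
case: eqP => [e|]; last by rewrite mulr0.
by case/eqP: wU; apply/val_inj.
Qed.

(** The variational inequality with test function [t * S w ^+ 2]: a bound on relative entropy
    transfers smallness of the second moment of [S] from [gibbs_weight] to [m], up to [D / t]. *)
Lemma sqr_variational (m : seq bool -> R) n t (S : seq bool -> R) D :
  invariant_weight m -> 0 < t -> (forall w, `|S w| <= 1) ->
  word_mean m (fun w => ln (m w) - ln (gibbs_weight w)) n <= D ->
  t * word_mean m (fun w => S w ^+ 2) n <=
    D + t * expR t * word_mean gibbs_weight (fun w => S w ^+ 2) n.
Proof.
move=> mP t0 S1 HD; have [_ m0 _ _] := mP.
have gP := gibbs_weightP u1 v1.
have := @gibbs_variational _ (n.-tuple bool) (fun w => m w) (fun w => gibbs_weight w)
  (fun w => t * S w ^+ 2) (fun w => m0 w) (fun w => gibbs_weight_gt0 w).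
rewrite (weight_sum1 mP) -[X in _ - X](weight_sum1 gP n) -sumrB => h.
have -> : t * word_mean m (fun w => S w ^+ 2) n =
    \sum_(w : n.-tuple bool) m w * (t * S w ^+ 2).
  by rewrite mulr_sumr; apply: eq_bigr => w _; rewrite mulrCA.
apply: le_trans h _; apply: lerD => //; rewrite /word_mean mulr_sumr.
apply: ler_sum => w _; rewrite -[X in _ - X]mulr1 -mulrBr [leRHS]mulrCA.
rewrite ler_pM2l ?gibbs_weight_gt0//.
set y := S w ^+ 2.
have y01 : 0 <= y <= 1.
  rewrite sqr_ge0 /y -[S w ^+ 2]ger0_norm ?sqr_ge0// normrX.
  by rewrite exprn_ile1.
have /andP[y0 y1] := y01.
have ty : 0 <= t * y by rewrite mulr_ge0// ltW.
have h1 := expR_ge1Dx (- (t * y)).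
(* This is [1 - x <= expR (- x)] multiplied by [expR x]. It keeps the bound linear in [y], so that
   only the second moment of [S] appears. *)
have h2 : expR (t * y) - 1 <= (t * y) * expR (t * y).
  have := ler_wpM2r (ltW (expR_gt0 (t * y))) h1.
  by rewrite -expRD addNr expR0 mulrDl mul1r mulNr; lra.
apply: le_trans h2 _; rewrite mulrAC ler_wpM2r//.
apply: ler_wpM2l; first exact: ltW.
by rewrite ler_expR; apply: ler_piMr => //; apply: ltW.
Qed.

(** The hypothesis at every length, with the Gibbs bounds, keeps the relative entropy below [K] for
    all [n]. The test function is the centred empirical frequency of [U]: under [m] its mean is
    [m U - c], while under [gibbs_weight] its variance is at most [C / n]. *)
Lemma gibbs_weight_unique (m : seq bool -> R) : invariant_weight m ->
  (forall n, n%:R * ln growth <= word_entropy m n + word_mean m (fun w => ln (Phi w)) n) ->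
  m =1 gibbs_weight.
Proof.
move=> mP mF U; have [_ m0 _ _] := mP.
have gP := gibbs_weightP u1 v1.
have [K K0 HK] := ln_gibbs_bounds.
have HD n : word_mean m (fun w => ln (m w) - ln (gibbs_weight w)) n <= K.
  have := mF n.
  have -> : n%:R * ln growth = \sum_(w : n.-tuple bool) m w * (n%:R * ln growth).
    by rewrite -mulr_suml weight_sum1// mul1r.
  rewrite /word_entropy /word_mean [leRHS]addrC -sumrB -subr_ge0 -sumrB => h.
  rewrite -[leRHS]subr0 lerBrDr; apply: le_trans (lerD (lexx _) h) _.
  rewrite -[leRHS]mul1r -[in leRHS](weight_sum1 mP n) mulr_suml -big_split.
  apply: ler_sum => w _ /=; have := HK w; rewrite size_tuple ler_norml => /andP[h1 h2].
  rewrite (_ : m w * (ln (m w) - ln (gibbs_weight w)) + (m w * ln (Phi w) -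
      m w * ln (m w) - m w * (n%:R * ln growth)) = m w * - (ln (gibbs_weight w) - ln (Phi w) + n%:R * ln growth)).
    by rewrite ler_wpM2l//; lra.
  by ring.
pose j := size U; pose c := gibbs_weight U.
pose f := fun (z : bool * bool) (w : seq bool) => (prefix U w)%:R - c.
have c01 : 0 <= c <= 1 by rewrite /c ltW ?gibbs_weight_gt0//= (weight_le1 gP).
have f1 z w : `|f z w| <= 1.
  case/andP: c01 => c0 c1; rewrite /f ler_norml; case: prefix; rewrite ?mulr1n ?mulr0n;
    apply/andP; split; lra.
have fj z : depends_on_first j (f z) by apply: prefix_depends_on_first.
have f0 : stationary_mean u v (fun z => chain_mean u v j z (f z)) = 0.
  by rewrite -(word_mean_gibbs_weight u1 v1 (f (true, true)) j) word_mean_prefix// subrr.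
have [C C0 HC] := birkhoff_variance u1 v1 fj f1 f0.
have zz n z z' w : birkhoff step f n z w = birkhoff step f n z' w.
  by elim: n z z' w => //= n IH z z' w; congr (_ + _); apply: IH.
pose z0 := (true, true); pose S n w := n%:R^-1 * birkhoff step f n z0 w.
have key n t : (0 < n)%N -> 0 < t -> t * (m U - c) ^+ 2 <= K + t * expR t * (C / n%:R).
  move=> n0 t0; have nR : 0 < n%:R :> R by rewrite ltr0n.
  have S1 w : `|S n w| <= 1.
    rewrite /S normrM ger0_norm ?invr_ge0// ler_pdivrMl// mulr1.
    by have := birkhoff_le step n z0 w f1; rewrite mulr1.
  have h := sqr_variational mP t0 S1 (HD (n + j)%N).
  apply: (le_trans _ (le_trans h _)).
    rewrite ler_pM2l//; apply: le_trans _ (word_mean_sqr mP _ _).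
    suff -> : word_mean m (S n) (n + j) = m U - c by [].
    have := word_mean_birkhoff step n z0 mP (fj z0).
    rewrite word_mean_prefix// => e.
    rewrite word_meanM.
    rewrite -[LHS]/(n%:R^-1 * word_mean m (birkhoff step (fun=> f z0) n z0) (n + j)).
    by rewrite e mulKf// gt_eqF.
  rewrite lerD2l ler_wpM2l// ?mulr_ge0 ?expR_ge0//; first by apply: ltW.
  have -> : word_mean gibbs_weight (fun w => S n w ^+ 2) (n + j) = n%:R ^- 2 *
      stationary_mean u v (fun z => chain_mean u v (n + j) z
        (fun w => birkhoff step f n z w ^+ 2)).
    rewrite word_mean_gibbs_weight// /stationary_mean mulrA mulr_sumr; congr (_ / _).
    apply: eq_bigr => z _; rewrite [RHS]mulrCA; congr (_ * _); rewrite -chain_meanM.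
    by apply: chain_mean_ext => w; rewrite /S exprMn exprVn (zz n z0 z).
  have -> : C / n%:R = n%:R ^- 2 * (n%:R * C) by field; rewrite gt_eqF.
  by apply: ler_wpM2l (HC n); rewrite invr_ge0 exprn_ge0.
apply/eqP; rewrite -subr_eq0 -sqrf_eq0; apply/negPn/negP => dN.
have d0 : 0 < (m U - c) ^+ 2 by rewrite lt_neqAle eq_sym dN sqr_ge0.
(* This makes the left side of [key] equal to [K + 1]. With [t] fixed, the last term of [key] falls
   below 1 for large [n], a contradiction. *)
pose t := (K + 1) / (m U - c) ^+ 2.
have t0 : 0 < t by rewrite divr_gt0// ltr_wpDl.
pose E := t * expR t * C.
have [n En] : exists n, E < n.+1%:R.
  exists (Num.bound `|E|); apply: le_lt_trans (ler_norm _) _.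
  apply: lt_trans (archi_boundP (normr_ge0 _)) _; rewrite ltr_nat//.
have := key n.+1 t isT t0; rewrite /t mulfVK// -/t lerD2l mulrA ler_pdivlMr// mul1r.
by rewrite leNgt En.
Qed.

End gibbs_property.

(** * Borel probability measures on the sequence space *)

Definition cylinder (w : seq bool) : set Sigma2 :=
  [set x | prefix_word (size w) x = w].

Lemma prefix_wordS n (x : Sigma2) : prefix_word n.+1 x = rcons (prefix_word n x) (x n).
Proof. exact: mkseqS. Qed.

Lemma prefix_wordSl n (x : Sigma2) :
  prefix_word n.+1 x = x 0%N :: prefix_word n (left_shift x).
Proof.
by rewrite /prefix_word /mkseq /= -[1%N]addn0 iotaDl -map_comp.
Qed.

Lemma size_prefix_word n x : size (prefix_word n x) = n.
Proof. exact: size_mkseq. Qed.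

Lemma take_prefix_word n m x : (n <= m)%N -> take n (prefix_word m x) = prefix_word n x.
Proof. by move=> nm; rewrite /prefix_word /mkseq -map_take take_iota (minn_idPl nm). Qed.

Lemma measurable_coord n (b : bool) : measurable [set x : Sigma2 | x n = b].
Proof.
apply: sub_gen_smallest.
have -> : [set x : Sigma2 | x n = b] = (@proj nat (fun=> bool) n) @^-1` [set b] by [].
apply: open_comp; last exact: discrete_open.
by move=> x _; apply: proj_continuous.
Qed.

Lemma measurable_prefix n (S : set (seq bool)) :
  measurable [set x : Sigma2 | S (prefix_word n x)].
Proof.
elim: n S => [|n IH] S.
  have [s|s] := pselect (S [::]).
    by rewrite (_ : mkset _ = setT)//; apply/seteqP; split.
  by rewrite (_ : mkset _ = set0)//; apply/seteqP; split.
have -> : [set x : Sigma2 | S (prefix_word n.+1 x)] =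
  ([set x | S (rcons (prefix_word n x) true)] `&` [set x | x n = true]) `|`
  ([set x | S (rcons (prefix_word n x) false)] `&` [set x | x n = false]).
  apply/seteqP; split => x /=; rewrite prefix_wordS.
    by case: (x n) => H; [left|right].
  by case=> -[H ->].
apply: measurableU; apply: measurableI; try exact: measurable_coord.
  exact: (IH (fun w => S (rcons w true))).
exact: (IH (fun w => S (rcons w false))).
Qed.

Lemma measurable_cylinder w : measurable (cylinder w).
Proof. exact: (measurable_prefix (size w) [set w]). Qed.

Lemma cylinder_prefix n (x : Sigma2) :
  cylinder (prefix_word n x) = [set y | prefix_word n y = prefix_word n x].
Proof. by rewrite /cylinder size_prefix_word. Qed.

(** The cylinders around [x] are a filter base converging to [x] in every coordinate, that is, in
    the product topology; so one of them enters [U]. *)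
Lemma open_cylinder (U : set cantor_space) x : open U -> U x ->
  exists n, cylinder (prefix_word n x) `<=` U.
Proof.
move=> oU Ux.
pose B n : set cantor_space := cylinder (prefix_word n x).
have BS n m : (n <= m)%N -> B m `<=` B n.
  move=> nm y; rewrite /B !cylinder_prefix /= => e.
  by rewrite -(take_prefix_word y nm) e take_prefix_word.
pose F := filter_from setT B.
have FF : Filter F.
  apply: filter_from_filter; first by exists 0%N.
  move=> i j _ _; exists (maxn i j) => // y By.
  by split; apply: BS By; rewrite ?leq_maxl ?leq_maxr.
have cF : F --> (x : cantor_space).
  apply/(@pointwise_cvgP nat bool F x FF) => i A /= Ai; exists i.+1 => // y.
  rewrite /B cylinder_prefix /= !prefix_wordS => /rcons_inj[_ yi].
  by rewrite yi; apply: nbhs_singleton.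
have [n _ nU] : F U by apply: cF; apply: open_nbhs_nbhs.
by exists n.
Qed.

Definition cylinders : set (set Sigma2) := [set A | A = set0 \/ exists w, A = cylinder w].

Lemma measurable_cylinders : @measurable _ Sigma2 = <<s cylinders >>.
Proof.
apply/seteqP; split.
  apply: smallest_sub; first exact: smallest_sigma_algebra.
  move=> U oU.
  (* [F w] is the cylinder if it lies in [U] and empty otherwise, so the union can run over the
     whole countable type of words. *)
  pose F w : set Sigma2 := cylinder w `&` [set _ | cylinder w `<=` U].
  have -> : U = \bigcup_w F w.
    apply/seteqP; split => [x Ux|x [w _ [xw wU]]]; last exact: wU.
    have [n nU] := open_cylinder oU Ux; exists (prefix_word n x) => //.
    by rewrite /F cylinder_prefix; split => //=; rewrite -cylinder_prefix.
  apply: (@countable_bigcupT_measurable _ (g_sigma_algebraType cylinders)) => [|w].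
    exact: countableP.
  rewrite /F; have [wU|wU] := pselect (cylinder w `<=` U).
    rewrite (_ : [set _ | _] = setT); last by apply/seteqP; split.
    by rewrite setIT; apply: sub_gen_smallest; right; exists w.
  rewrite (_ : [set _ | _] = set0); last by apply/seteqP; split.
  by rewrite setI0; apply: measurable0.
apply: smallest_sub; first exact: sigma_algebra_measurable.
by move=> A [->|[w ->]]; [exact: measurable0|exact: measurable_cylinder].
Qed.

Lemma setI_closed_cylinders : setI_closed cylinders.
Proof.
suff H w w' : (size w <= size w')%N -> cylinders (cylinder w `&` cylinder w').
  move=> A B [->|[w ->]]; first by rewrite set0I; left.
  move=> [->|[w' ->]]; first by rewrite setI0; left.
  have [ww'|ww'] := leqP (size w) (size w'); first exact: H.
  by rewrite setIC; apply: H; apply: ltnW.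
move=> ww'; have [e|ne] := eqVneq (take (size w) w') w.
  right; exists w'; apply/setIidPr => x; rewrite /cylinder /= => xw'.
  by rewrite -(take_prefix_word x ww') xw'.
left; apply/seteqP; split => // x [] /=; rewrite /cylinder /= => xw xw'.
by case/eqP: ne; rewrite -xw' take_prefix_word.
Qed.

Lemma cylinder_nil : cylinder [::] = setT.
Proof. by apply/seteqP; split. Qed.

Lemma probability_eq_cylinders (R : realType) (mu nu : probability Sigma2 R) :
  (forall w, mu (cylinder w) = nu (cylinder w)) ->
  forall A, measurable A -> mu A = nu A.
Proof.
move=> e; apply: (measure_unique cylinders (fun=> setT)).
- exact: measurable_cylinders.
- exact: setI_closed_cylinders.
- by move=> _; right; exists [::]; rewrite cylinder_nil.
- by apply/seteqP; split => // x _; exists 0%N.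
- by move=> A [->|[w ->]]; [rewrite !measure0|exact: e].
- by move=> _ /=; rewrite (@probability_setT _ _ _ mu) ltry.
Qed.

Lemma measurable_fun_Sigma2 d (T : measurableType d) (F : T -> Sigma2) :
  (forall w, measurable [set t | prefix_word (size w) (F t) = w]) -> measurable_fun setT F.
Proof.
move=> mF; apply: (measurability cylinders measurable_cylinders).
move=> _ [A [->|[w ->]] <-]; rewrite setTI; last exact: mF.
by rewrite preimage_set0.
Qed.

(** * A measure with prescribed cylinder masses, as an image of Lebesgue measure *)

Section cylinder_measure.
Variables (R : realType).

Definition lebesgue01 := mrestr (@lebesgue_measure R) (measurable_itv `[0%R, 1%R[).

HB.instance Definition _ := Measure.on lebesgue01.

Lemma lebesgue01_setT : lebesgue01 [set: _] = 1%E.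
Proof. by rewrite /lebesgue01 /mrestr setTI lebesgue_measure_itv /= lte01 sube0. Qed.

HB.instance Definition _ := @Measure_isProbability.Build _ _ R lebesgue01 lebesgue01_setT.

Variable m : seq bool -> R.
Hypotheses (m1 : m [::] = 1) (m0 : forall w, 0 <= m w)
  (mr : forall w, \sum_(a : bool) m (rcons w a) = m w).

(* Points of [0, 1[ are coded by successive subdivision: the interval attached
   to [w] has length [m w], that of [rcons w false] being on the left. *)
Fixpoint code (t : R) n : seq bool * R :=
  if n is n'.+1 then
    let wl := code t n' in
    let c := wl.2 + m (rcons wl.1 false) in
    if c <= t then (rcons wl.1 true, c) else (rcons wl.1 false, wl.2)
  else ([::], 0).

Definition coding (t : measurableTypeR R) : Sigma2 :=
  fun n => (code t n).2 + m (rcons (code t n).1 false) <= t.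

Lemma prefix_coding t n : prefix_word n (coding t) = (code t n).1.
Proof.
by elim: n => // n IH; rewrite prefix_wordS IH /coding /=; case: ifP.
Qed.

(** The stored left endpoint depends on the word alone, which lets the induction identify the next
    cut. Measurability is asserted on the whole line, where [coding] is defined; the description by
    an interval only on [[0, 1[], which carries the measure. *)
Lemma code_interval w : exists l, [/\ 0 <= l, l + m w <= 1,
  forall t, (code t (size w)).1 = w -> (code t (size w)).2 = l,
  measurable [set t : measurableTypeR R | (code t (size w)).1 = w] &
  forall t, 0 <= t < 1 -> (code t (size w)).1 = w <-> l <= t < l + m w].
Proof.
elim/last_ind: w => [|w a [l [l0 l1 Hl mw IH]]].
  exists 0; split => //; rewrite ?m1 ?add0r//.
  by rewrite (_ : mkset _ = setT)//; apply/seteqP; split.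
set c := l + m (rcons w false).
have mwE : m w = m (rcons w true) + m (rcons w false) by rewrite -mr sum_bool.
have step_true t : (code t (size w).+1).1 = rcons w true <->
    (code t (size w)).1 = w /\ c <= t.
  split=> /=.
    by case: ifP => /= [h /rcons_inj[e]|_ /rcons_inj[]//]; split => //; move: h; rewrite e Hl.
  by move=> [e ct]; rewrite e Hl// -/c ct.
have step_false t : (code t (size w).+1).1 = rcons w false <->
    (code t (size w)).1 = w /\ t < c.
  split=> /=.
    case: ifP => /= [_ /rcons_inj[]//|h /rcons_inj[e]]; split => //; move: h; rewrite e Hl//.
    by move/negbT; rewrite -ltNge.
  by move=> [e ct]; rewrite e Hl// -/c leNgt ct.
have mt := m0 (rcons w true); have mf := m0 (rcons w false).
rewrite size_rcons; case: a.
  exists c; split.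
  - by rewrite addr_ge0.
  - by rewrite /c -addrA [_ + m (rcons w true)]addrC -mwE.
  - move=> t /step_true[e ct] /=; rewrite e Hl// -/c ct//.
  - rewrite (_ : mkset _ = [set t | (code t (size w)).1 = w] `&` `[c, +oo[%classic).
      exact: measurableI.
    apply/seteqP; split => t /=; rewrite in_itv /= andbT; first by move/step_true.
    by move=> ?; apply/step_true.
  - move=> t t01; split.
      move=> /step_true[/(IH _ t01)/andP[_ h2] ->] /=.
      by apply: lt_le_trans h2 _; rewrite mwE /c; lra.
    move=> /andP[h1 h2]; apply/step_true; split => //; apply/(IH _ t01).
    by move: h1 h2; rewrite mwE /c => h1 h2; apply/andP; split; lra.
exists l; split => //.
- by apply: le_trans l1; rewrite lerD2l mwE lerDr.
- move=> t /step_false[e ct] /=; rewrite e Hl// -/c leNgt ct//.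
- rewrite (_ : mkset _ = [set t | (code t (size w)).1 = w] `&` `]-oo, c[%classic).
    exact: measurableI.
  apply/seteqP; split => t /=; rewrite in_itv /=; first by move/step_false.
  by move=> ?; apply/step_false.
- move=> t t01; split.
    by move=> /step_false[/(IH _ t01)/andP[h1 _] h2]; rewrite h1.
  move=> /andP[h1 h2]; apply/step_false; split => //; apply/(IH _ t01).
  by rewrite h1 mwE; apply: lt_le_trans h2 _; lra.
Qed.

Lemma measurable_coding : measurable_fun setT coding.
Proof.
apply: measurable_fun_Sigma2 => w; under eq_set do rewrite prefix_coding.
by have [l []] := code_interval w.
Qed.

HB.instance Definition _ := @isMeasurableFun.Build _ _ _ _ coding measurable_coding.

Lemma cylinder_measure_exists :
  exists mu : probability Sigma2 R, forall w, mu (cylinder w) = (m w)%:E.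
Proof.
exists (distribution lebesgue01 coding) => w.
rewrite -[LHS]/(lebesgue_measure ((coding @^-1` cylinder w) `&` `[0%R, 1%R[%classic)).
have [l [l0 l1 _ _ Hl]] := code_interval w.
rewrite (_ : _ `&` _ = `[l, l + m w[%classic).
  rewrite lebesgue_measure_itv /= lte_fin ltrDl.
  case: ltP => [_|mw]; first by rewrite -EFinB addrC addKr.
  by congr EFin; apply/eqP; rewrite eq_le m0 mw.
apply/seteqP; split => t /=; rewrite /cylinder /= prefix_coding !in_itv /=.
  by move=> [e t01]; apply/Hl.
move=> h; have t01 : 0 <= t < 1.
  case/andP: h => h1 h2; rewrite (le_trans l0 h1)/=; exact: lt_le_trans l1.
by split=> //; apply/Hl.
Qed.

End cylinder_measure.

(** * Finite-valued random variables and cylinder approximation *)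

Section real_probability.
Context d (T : measurableType d) (R : realType) (P : probability T R).

Definition pr (A : set T) : R := fine (P A).

Lemma pr_fineK A : measurable A -> P A = (pr A)%:E.
Proof. by move=> mA; rewrite fineK// fin_num_measure. Qed.

Lemma pr_ge0 A : 0 <= pr A.
Proof. exact: fine_ge0. Qed.

Lemma pr_setT : pr setT = 1.
Proof. by rewrite /pr probability_setT. Qed.

Lemma pr_set0 : pr set0 = 0.
Proof. by rewrite /pr measure0. Qed.

Lemma pr_le A B : measurable A -> measurable B -> A `<=` B -> pr A <= pr B.
Proof.
move=> mA mB AB; rewrite -lee_fin -!pr_fineK//.
by apply: le_measure => //; rewrite inE.
Qed.

Lemma prU A B : measurable A -> measurable B -> A `&` B = set0 ->
  pr (A `|` B) = pr A + pr B.
Proof.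
move=> mA mB AB; apply: EFin_inj; rewrite EFinD -!pr_fineK ?measureU//.
exact: measurableU.
Qed.

Lemma prU_le A B : measurable A -> measurable B -> pr (A `|` B) <= pr A + pr B.
Proof.
move=> mA mB; rewrite -[A `|` B](setDUK (@subsetUl _ A B)) setDUl setDv set0U.
rewrite prU//; first by rewrite lerD2l pr_le//; apply: measurableD.
- exact: measurableD.
- by rewrite setDE setIA setIC setIA [_ `&` A]setIC setICr set0I.
Qed.

Definition finite_rv (I : finType) (X : T -> I) := forall i, measurable (X @^-1` [set i]).

Definition law (I : finType) (X : T -> I) (i : I) : R := pr (X @^-1` [set i]).

Section finite_laws.
Variables (I : finType) (X : T -> I).
Hypothesis mX : finite_rv X.

Lemma law_mem (s : seq I) : uniq s ->
  measurable (X @^-1` [set i | i \in s]) /\ pr (X @^-1` [set i | i \in s]) = \sum_(i <- s) law X i.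
Proof.
elim: s => [_|i s IH /= /andP[Nis us]].
  rewrite big_nil (_ : [set i | i \in [::]] = set0) ?preimage_set0; last by apply/seteqP; split.
  by split; [exact: measurable0|exact: pr_set0].
have [ms es] := IH us.
have -> : X @^-1` [set j | j \in i :: s] = X @^-1` [set i] `|` X @^-1` [set j | j \in s].
  apply/seteqP; split => x /=; rewrite inE; first by case/predU1P; [left|right].
  by case=> ->; rewrite ?eqxx ?orbT.
split; first exact: measurableU.
rewrite big_cons -es prU//; apply/seteqP; split => // x /= [xi]; rewrite xi => h.
by rewrite h in Nis.
Qed.

Lemma law_pred (A : pred I) :
  measurable (X @^-1` [set i | A i]) /\ pr (X @^-1` [set i | A i]) = \sum_(i | A i) law X i.
Proof.
have [h e] := @law_mem (enum A) (enum_uniq _).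
have -> : [set i | A i] = [set i | i \in enum A].
  by apply/seteqP; split => x /=; rewrite mem_enum.
by split => //; rewrite e big_enum.
Qed.

Lemma law_comp (J : finType) (f : I -> J) j :
  law (f \o X) j = \sum_(i | f i == j) law X i.
Proof.
have [_ <-] := law_pred (fun i => f i == j); congr pr.
by apply/seteqP; split => x /= /eqP.
Qed.

Lemma finite_rv_comp (J : finType) (f : I -> J) : finite_rv (f \o X).
Proof.
move=> j; have [h _] := law_pred (fun i => f i == j); move: h; congr measurable.
by apply/seteqP; split => x /= /eqP.
Qed.

Lemma law_mean_comp (J : finType) (f : I -> J) (F : J -> R) :
  \sum_j law (f \o X) j * F j = \sum_i law X i * F (f i).
Proof.
rewrite [RHS](partition_big f xpredT)//=; apply: eq_bigr => j _.
by rewrite law_comp mulr_suml; apply: eq_bigr => i /eqP ->.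
Qed.

Lemma law_sum1 : \sum_i law X i = 1.
Proof.
have [_ <-] := law_pred xpredT; rewrite -pr_setT; congr pr.
by apply/seteqP; split.
Qed.

Lemma law_ge0 i : 0 <= law X i.
Proof. exact: pr_ge0. Qed.

End finite_laws.
End real_probability.

Section shift_measures.
Variables (R : realType) (nu : probability Sigma2 R).
Local Notation law := (law nu).

Definition cylinder_weight (w : seq bool) : R := pr nu (cylinder w).

Definition prefix_tuple n (x : Sigma2) : n.-tuple bool :=
  Tuple (introT eqP (size_prefix_word n x)).

Lemma prefix_tuple_preimage n (w : n.-tuple bool) :
  prefix_tuple n @^-1` [set w] = cylinder w.
Proof.
apply/seteqP; split => x /=; rewrite /cylinder /= size_tuple; first by move=> <-.
by move=> e; apply/val_inj.
Qed.

Lemma law_prefix n w : law (prefix_tuple n) w = cylinder_weight w.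
Proof. by rewrite /law prefix_tuple_preimage. Qed.

Lemma finite_rv_prefix n : finite_rv (prefix_tuple n).
Proof. by move=> w; rewrite prefix_tuple_preimage; apply: measurable_cylinder. Qed.

Lemma measurable_left_shift A : measurable A -> measurable (left_shift @^-1` A).
Proof.
move=> mA; rewrite -[_ @^-1` _]setTI.
have : measurable_fun setT left_shift.
  apply: measurable_fun_Sigma2 => w.
  have := measurable_prefix (size w).+1 [set w' | behead w' = w].
  by congr measurable; apply/funext => x; rewrite /mkset prefix_wordSl.
by apply.
Qed.

Lemma cylinder_rcons w :
  cylinder w = cylinder (rcons w true) `|` cylinder (rcons w false).
Proof.
apply/seteqP; split => x; rewrite /cylinder /= !size_rcons prefix_wordS.
  by move=> ->; case: (x _); [left|right].
by case=> /rcons_inj[].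
Qed.

Lemma cylinder_cons w : left_shift @^-1` cylinder w =
  cylinder (true :: w) `|` cylinder (false :: w).
Proof.
apply/seteqP; split => x; rewrite /cylinder /= prefix_wordSl.
  by move=> ->; case: (x _); [left|right].
by case=> -[].
Qed.

Lemma cylinder_weightP : invariant_measure nu left_shift -> invariant_weight cylinder_weight.
Proof.
move=> inv; split.
- by rewrite /cylinder_weight cylinder_nil pr_setT.
- by move=> w; apply: pr_ge0.
- move=> w; rewrite sum_bool /cylinder_weight [in RHS]cylinder_rcons prU//; try exact: measurable_cylinder.
  by apply/seteqP; split => // x []; rewrite /cylinder /= !size_rcons => -> /rcons_inj[].
- move=> w; rewrite sum_bool /cylinder_weight.
  rewrite [in RHS]/pr -(inv _ (measurable_cylinder w)) cylinder_cons -[RHS]/(pr nu _).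
  rewrite prU//; try exact: measurable_cylinder.
  by apply/seteqP; split => // x []; rewrite /cylinder /= => -> [].
Qed.

Lemma law_shift (I : finType) (X : Sigma2 -> I) j i : invariant_measure nu left_shift ->
  finite_rv X -> law (X \o iter j left_shift) i = law X i.
Proof.
move=> inv mX.
suff H : measurable ((X \o iter j left_shift) @^-1` [set i]) /\
    law (X \o iter j left_shift) i = law X i by case: H.
elim: j => [|j [mj IH]]; first by split => //; apply: mX.
have -> : X \o iter j.+1 left_shift = (X \o iter j left_shift) \o left_shift.
  by apply/funext => x /=; rewrite -iterS iterSr.
rewrite comp_preimage; split; first exact: measurable_left_shift.
by rewrite -IH /law /pr comp_preimage inv.
Qed.

Definition set_dist (A B : set Sigma2) : R := pr nu ((A `\` B) `|` (B `\` A)).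

Definition approximable (A : set Sigma2) := measurable A /\
  forall e, 0 < e -> exists N (S : set (seq bool)),
    set_dist A [set x | S (prefix_word N x)] < e.

Lemma measurable_diffs (A B : set Sigma2) : measurable A -> measurable B ->
  measurable ((A `\` B) `|` (B `\` A)).
Proof. by move=> mA mB; apply: measurableU; apply: measurableD. Qed.

Lemma approximableC A : approximable A -> approximable (~` A).
Proof.
move=> [mA hA]; split => [|e e0]; first exact: measurableC.
have [N [S NS]] := hA e e0; exists N, (~` S).
rewrite (_ : set_dist _ _ = set_dist A [set x | S (prefix_word N x)])//.
congr pr; apply/seteqP; split => x /= [] [a b].
- by right; split => //; apply: contrapT.
- by left; split => //; apply: contrapT.
- by right; split => //; move=> c; apply: c.
- by left; split => //; move=> c; apply: c.
Qed.

Lemma approximable_prefix n (S : set (seq bool)) : approximable [set x | S (prefix_word n x)].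
Proof.
split => [|e e0]; first exact: measurable_prefix.
by exists n, S; rewrite /set_dist setDv setU0 pr_set0.
Qed.

Lemma approximableU A B : approximable A -> approximable B -> approximable (A `|` B).
Proof.
move=> [mA hA] [mB hB]; split => [|e e0]; first exact: measurableU.
have e2 : 0 < e / 2 by rewrite divr_gt0.
have [N [S NS]] := hA _ e2; have [M [S' MS]] := hB _ e2.
exists (maxn N M), [set w | S (take N w) \/ S' (take M w)].
rewrite (splitr e); apply: le_lt_trans (ltrD NS MS).
have mS := measurable_prefix N S; have mS' := measurable_prefix M S'.
apply: (le_trans _ (prU_le nu (measurable_diffs mA mS) (measurable_diffs mB mS'))).
apply: pr_le.
- apply: measurable_diffs; first exact: measurableU.
  exact: (measurable_prefix _ [set w | S (take N w) \/ S' (take M w)]).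
- by apply: measurableU; apply: measurable_diffs.
move=> x /=; rewrite !take_prefix_word ?leq_maxl ?leq_maxr//.
have [a|a] := pselect (A x); have [b|b] := pselect (B x);
have [s|s] := pselect (S (prefix_word N x)); have [s'|s'] := pselect (S' (prefix_word M x)); tauto.
Qed.

Lemma approximable_bigcup (F : (set Sigma2)^nat) :
  (forall i, approximable (F i)) -> approximable (\bigcup_i F i).
Proof.
move=> aF.
have mF : measurable (\bigcup_i F i) by apply: bigcup_measurable => i _; case: (aF i).
split => // e e0.
have e2 : 0 < e / 2 by rewrite divr_gt0.
pose U n := \big[setU/set0]_(i < n.+1) F i.
have aU n : approximable (U n).
  rewrite /U; elim: n.+1 => [|k IH]; last by rewrite big_ord_recr; apply: approximableU.
  rewrite big_ord0 (_ : set0 = [set x | set0 (prefix_word 0 x)]).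
    exact: approximable_prefix.
  by apply/seteqP; split.
have mU n : measurable (U n) by case: (aU n).
have UF : \bigcup_n U n = \bigcup_i F i by exact: bigcup_bigsetU_bigcup.
have cU : (nu \o U) @ \oo --> nu (\bigcup_i F i).
  rewrite -UF; apply: nondecreasing_cvg_mu => //; first by rewrite UF.
  by move=> n m nm; apply/subsetPset; apply: subset_bigsetU.
have [n hn] : exists n, pr nu (\bigcup_i F i) - e / 2 < pr nu (U n).
  have cU' : (fun n => pr nu (U n)) @ \oo --> pr nu (\bigcup_i F i).
    by apply: fine_cvg; rewrite -pr_fineK.
  have /cvgrPdist_lt/(_ _ e2)[n _ /(_ n (leqnn n))/=] := cU'.
  by move=> h; exists n; move: h; rewrite ltr_distlC => /andP[h _]; lra.
have [_ /(_ _ e2)[N [S NS]]] := aU n; exists N, S.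
have UFn : U n `<=` \bigcup_i F i by rewrite -UF => x Ux; exists n.
have mS := measurable_prefix N S.
have mD : measurable (\bigcup_i F i `\` U n) by apply: measurableD.
have hD : pr nu (\bigcup_i F i `\` U n) < e / 2.
  have := prU nu (mU n) mD (setDIK _ _).
  by rewrite setDUK// => h; lra.
rewrite (splitr e); apply: le_lt_trans (ltrD hD NS).
apply: (le_trans _ (prU_le nu mD (measurable_diffs (mU n) mS))).
apply: pr_le.
- exact: measurable_diffs.
- by apply: measurableU => //; apply: measurable_diffs.
move=> x /=; have [a|a] := pselect (U n x); have := UFn x.
have [s|s] := pselect (S (prefix_word N x)); tauto.
have [s|s] := pselect (S (prefix_word N x)); tauto.
Qed.

(** The approximable sets form a sigma-algebra that contains the cylinders. *)
Lemma measurable_approximable A : measurable A -> approximable A.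
Proof.
rewrite measurable_cylinders; apply: smallest_sub.
  split.
  - rewrite (_ : set0 = [set x | set0 (prefix_word 0 x)]); last by apply/seteqP; split.
    exact: approximable_prefix.
  - by move=> B aB; rewrite setTD; apply: approximableC.
  - exact: approximable_bigcup.
move=> B [->|[w ->]].
  rewrite (_ : set0 = [set x | set0 (prefix_word 0 x)]); last by apply/seteqP; split.
  exact: approximable_prefix.
exact: (approximable_prefix (size w) [set w]).
Qed.

End shift_measures.

(** * The Kolmogorov-Sinai theorem *)

Section kolmogorov_sinai.
Variables (R : realType) (nu : probability Sigma2 R).
Hypothesis inv : invariant_measure nu left_shift.
Local Notation law := (law nu).
Local Notation weight := (cylinder_weight nu).
Let wP := cylinder_weightP inv.

Lemma finite_rv_tuple (I : finType) n (X : 'I_n -> Sigma2 -> I) :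
  (forall j, finite_rv (X j)) -> finite_rv (fun x => [tuple X j x | j < n]).
Proof.
move=> mX v.
have -> : (fun x => [tuple X j x | j < n]) @^-1` [set v] =
    \bigcap_(j in [set: 'I_n]) X j @^-1` [set tnth v j].
  apply/seteqP; split => x /=.
    by move=> <- j _ /=; rewrite tnth_mktuple.
  by move=> h; apply: eq_from_tnth => j; rewrite tnth_mktuple; apply: (h j).
by apply: fin_bigcap_measurable => [|j _]; [exact: finite_finset|exact: mX].
Qed.

Lemma finite_rv_pair (I J : finType) (X : Sigma2 -> I) (Y : Sigma2 -> J) :
  finite_rv X -> finite_rv Y -> finite_rv (fun x => (X x, Y x)).
Proof.
move=> mX mY [i j].
have -> : (fun x => (X x, Y x)) @^-1` [set (i, j)] = X @^-1` [set i] `&` Y @^-1` [set j].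
  by apply/seteqP; split => x /=; [case|case => -> ->].
exact: measurableI.
Qed.

Lemma finite_rv_shift (I : finType) (X : Sigma2 -> I) j :
  finite_rv X -> finite_rv (X \o iter j left_shift).
Proof.
move=> mX i; elim: j => [|j IH]; first exact: mX.
have -> : X \o iter j.+1 left_shift = (X \o iter j left_shift) \o left_shift.
  by apply/funext => x /=; rewrite -iterS iterSr.
by rewrite comp_preimage; apply: measurable_left_shift.
Qed.

Lemma drop_prefix_word j m x : drop j (prefix_word m x) = prefix_word (m - j) (iter j left_shift x).
Proof.
elim: j m x => [|j IH] m x; first by rewrite drop0 subn0.
case: m => [//|m]; rewrite prefix_wordSl /= IH subSS.
by congr prefix_word; rewrite -iterS iterSr.
Qed.

Lemma sum_tuple_prod (I : finType) n (F : 'I_n -> I -> R) :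
  \sum_(v : n.-tuple I) \prod_j F j (tnth v j) = \prod_j \sum_i F j i.
Proof.
rewrite bigA_distr_bigA (reindex (fun v : n.-tuple I => [ffun j => tnth v j])) /=.
  by apply: eq_bigr => v _; apply: eq_bigr => j _; rewrite ffunE.
exists (fun f : {ffun 'I_n -> I} => [tuple f j | j < n]) => [v _|f _].
  by apply: eq_from_tnth => j; rewrite tnth_mktuple ffunE.
by apply/ffunP => j; rewrite ffunE tnth_mktuple.
Qed.

Definition itinerary (I : finType) (q : Sigma2 -> I) n (x : Sigma2) : n.-tuple I :=
  [tuple q (iter j left_shift x) | j < n].

(** Each of the finitely many level sets of [q] is approximated within [d / #|I|], and the errors
    are added. *)
Lemma approximable_label (I : finType) (q : Sigma2 -> I) d : finite_rv q -> 0 < d ->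
  exists N (g : seq bool -> I),
    measurable [set x | q x != g (prefix_word N x)] /\
    pr nu [set x | q x != g (prefix_word N x)] < d.
Proof.
move=> mq d0.
have k0 : (0 < #|I|)%N by apply/card_gt0P; exists (q point).
pose e := d / #|I|%:R; have e0 : 0 < e by rewrite divr_gt0// ltr0n.
have /choice[NS HNS] : forall i, exists NS : nat * set (seq bool),
    set_dist nu (q @^-1` [set i]) [set x | NS.2 (prefix_word NS.1 x)] < e.
  move=> i; have [_ /(_ e e0)[N [S NS]]] := measurable_approximable nu (mq i).
  by exists (N, S).
pose N := \max_i (NS i).1.
have NN i : ((NS i).1 <= N)%N by apply: leq_bigmax.
(* The guess is any label whose approximating set contains the prefix, with an arbitrary default.
   Outside the sets [D i] exactly one label qualifies, namely the true one. *)
pose g w := odflt (q point) [pick i | `[< (NS i).2 (take (NS i).1 w) >]].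
pose D i := ((q @^-1` [set i]) `\` [set x | (NS i).2 (prefix_word (NS i).1 x)]) `|`
   ([set x | (NS i).2 (prefix_word (NS i).1 x)] `\` (q @^-1` [set i])).
have mD i : measurable (D i).
  by apply: measurable_diffs; [exact: mq|exact: measurable_prefix].
have mB : measurable [set x | q x != g (prefix_word N x)].
  have -> : [set x | q x != g (prefix_word N x)] =
    \bigcup_(i in [set: I]) ((q @^-1` [set i]) `&` [set x | [set w | i != g w] (prefix_word N x)]).
    apply/seteqP; split => x /=; first by move=> h; exists (q x).
    by move=> [i _ [/= <-]].
  apply: fin_bigcup_measurable => [|i _]; first exact: finite_finset.
  by apply: measurableI; [exact: mq|exact: measurable_prefix].
exists N, g; split => //.
have sub s : measurable (\big[setU/set0]_(i <- s) D i) /\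
    pr nu (\big[setU/set0]_(i <- s) D i) <= \sum_(i <- s) pr nu (D i) /\
    (forall i x, i \in s -> D i x -> (\big[setU/set0]_(i <- s) D i) x).
  elim: s => [|i s [ms [IH IH']]]; first by rewrite !big_nil pr_set0; split.
  rewrite !big_cons; split; first exact: measurableU.
  split; first by apply: le_trans (prU_le nu (mD i) ms) _; rewrite lerD2l.
  by move=> j x; rewrite inE => /predU1P[-> ?|js Dj]; [left|right; apply: IH' js Dj].
have [mU [leU inU]] := sub (index_enum I).
apply: (@le_lt_trans _ _ (pr nu (\big[setU/set0]_i D i))).
  apply: pr_le => // x /= /negP qg; apply: contrapT => nD.
  have qS i : q x = i <-> (NS i).2 (prefix_word (NS i).1 x).
    have nDi : ~ D i x by move=> Di; apply: nD; apply: inU Di; rewrite mem_index_enum.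
    split => [qi|si]; first by apply: contrapT => nS; apply: nDi; left.
    by apply: contrapT => nq; apply: nDi; right.
  apply: qg; rewrite /g; case: pickP => [i /asboolP|/(_ (q x))/asboolP]; rewrite take_prefix_word//.
    by move/qS ->.
  by move=> h; case: h; apply/qS.
apply: (le_lt_trans leU); have -> : d = \sum_(i : I) e.
  by rewrite sumr_const -mulr_natr /e mulfVK// pnatr_eq0 -lt0n.
apply: ltr_sum => [|i _]; last exact: HNS.
by apply/hasP; exists (q point); rewrite // mem_index_enum.
Qed.

(** The hard half of the Kolmogorov-Sinai theorem for the coordinate partition: an arbitrary finite
    partition has no larger entropy rate, up to [e]. *)
Lemma itinerary_entropy_le (I : finType) (q : Sigma2 -> I) e : finite_rv q -> 0 < e ->
  exists C, forall n,
  - \sum_(v : n.-tuple I) law (itinerary q n) v * ln (law (itinerary q n) v) <=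
    word_entropy weight n + n%:R * e + C.
Proof.
move=> mq e0; have [_ w0 _ _] := wP.
have k0 : (0 < #|I|)%N by apply/card_gt0P; exists (q point).
(* Calibration of the guesses: a right guess costs at most [- ln (1 - eta) = e / 2], a wrong one at
   most [b]. Wrong guesses have probability below [e / 2 / b], so they also cost at most [e / 2] per
   letter on average. *)
pose eta := 1 - expR (- (e / 2)).
have e2 : 0 < e / 2 by rewrite divr_gt0.
have eta0 : 0 < eta by rewrite subr_gt0 expR_lt1 oppr_lt0.
have eta1 : eta < 1 by rewrite ltrBlDr ltrDl expR_gt0.
pose b := ln (#|I|%:R / eta).
have ke1 : 1 < #|I|%:R / eta.
  by rewrite ltr_pdivlMr// mul1r (lt_le_trans eta1)// ler1n.
have b0 : 0 < b by rewrite ln_gt0.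
have [N [g [mB hB]]] := approximable_label mq (divr_gt0 e2 b0).
pose kappa i w : R := (1 - eta) * (i == g w)%:R + eta / #|I|%:R.
have kN0 : #|I|%:R != 0 :> R by rewrite pnatr_eq0 -lt0n.
have kp i w : 0 < kappa i w.
  rewrite /kappa ltr_wpDl//; first by rewrite mulr_ge0// subr_ge0 ltW.
  by rewrite divr_gt0// ltr0n.
have ksum w : \sum_i kappa i w = 1.
  rewrite big_split /= -mulr_sumr sumr_const -[eta / _ *+ _]mulr_natr mulfVK//.
  rewrite (bigD1 (g w))//= eqxx big1 ?addr0 ?mulr1 ?subrK// => i /negbTE -> //.
have kln i w : - ln (kappa i w) <= e / 2 + b * (i != g w)%:R.
  rewrite /kappa; case: eqP => [_|_] /=.
    rewrite mulr1 mulr0 addr0 lerNl -[- (e / 2)]expRK ler_ln ?posrE ?expR_gt0//.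
      rewrite (_ : 1 - eta = expR (- (e / 2))); last by rewrite /eta; ring.
      by rewrite lerDl divr_ge0// ltW.
    by rewrite ltr_pwDr ?divr_gt0 ?ltr0n// subr_ge0 ltW.
  by rewrite mulr0 add0r mulr1 -lnV ?posrE ?divr_gt0 ?ltr0n// invf_div lerDr ltW.
(* Guessing [n] successive labels requires [n + N] letters; subadditivity moves the surplus into
   this constant. *)
exists (word_entropy weight N) => n.
pose Y x := (itinerary q n x, prefix_tuple (n + N) x).
have mI : finite_rv (itinerary q n).
  by apply: finite_rv_tuple => j; apply: (finite_rv_shift j mq).
have mY : finite_rv Y by apply: finite_rv_pair => //; apply: finite_rv_prefix.
apply: (le_trans (entropy_map_le (f := fst) (p := law Y) _ _)).
- by move=> y; apply: law_ge0.
- by move=> v; rewrite -(law_comp nu mY fst).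
(* Gibbs' inequality against the law of the word times independent guesses of
   the labels, each read off [N] letters by [g] and correct up to [eta]. *)
pose kk (y : n.-tuple I * (n + N).-tuple bool) :=
  \prod_(j < n) kappa (tnth y.1 j) (take N (drop j y.2)).
have kkp y : 0 < kk y by apply: prodr_gt0.
apply: (le_trans (gibbs_inequality (p := law Y) (q := fun y => weight y.2 * kk y) _ _ _ _)).
- by move=> y; apply: law_ge0.
- by move=> y; rewrite mulr_ge0// ltW.
- move=> y /eqP; rewrite mulf_eq0 [kk y == 0]gt_eqF// orbF => /eqP wy.
  apply/eqP; rewrite eq_le law_ge0 andbT -wy -law_prefix -[prefix_tuple _]/(snd \o Y).
  rewrite (law_comp nu mY) (bigD1 y)//= lerDl sumr_ge0// => i _; exact: law_ge0.
- rewrite (law_sum1 nu mY).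
  rewrite -(pair_bigA _ (fun (v : n.-tuple I) (w : (n + N).-tuple bool) => weight w * kk (v, w))) /=.
  rewrite exchange_big -[leRHS](weight_sum1 wP (n + N)) /=; apply: ler_sum => w _.
  rewrite -mulr_sumr (sum_tuple_prod (fun (j : 'I_n) i => kappa i (take N (drop j w)))).
  by rewrite big1 ?mulr1.
rewrite -sumrN.
apply: (@le_trans _ _ (\sum_y (law Y y * - ln (weight y.2) +
   law Y y * (n%:R * (e / 2) + b * \sum_(j < n) (tnth y.1 j != g (take N (drop j y.2)))%:R)))).
  apply: ler_sum => y _; rewrite -mulrDr -mulrN.
  have := law_ge0 nu Y y; rewrite le_eqVlt => /predU1P[<-|y0]; first by rewrite !mul0r.
  rewrite ler_pM2l//.
  have wy : 0 < weight y.2.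
    rewrite -law_prefix -[prefix_tuple _]/(snd \o Y) (law_comp nu mY) (bigD1 y)//=.
    by rewrite (lt_le_trans y0)// lerDl sumr_ge0// => i _; exact: law_ge0.
  rewrite lnM ?posrE// opprD lerD2l /kk.
  have -> : ln (\prod_(j < n) kappa (tnth y.1 j) (take N (drop j y.2))) =
      \sum_(j < n) ln (kappa (tnth y.1 j) (take N (drop j y.2))).
    (* Positivity is carried along, since [ln] turns products into sums for positive factors. *)
    pose K (x y : R) := 0 < x /\ ln x = y.
    have [//] : K (\prod_(j < n) kappa (tnth y.1 j) (take N (drop j y.2)))
      (\sum_(j < n) ln (kappa (tnth y.1 j) (take N (drop j y.2)))).
    apply: (big_rec2 K) => [|j x1 x2 _ [x0 <-]]; first by rewrite /K ln1.
    by split; [rewrite mulr_gt0|rewrite lnM ?posrE].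
  rewrite -sumrN mulr_sumr -[n in n%:R]card_ord mulr_natl -sumr_const -big_split.
  by apply: ler_sum => j _; apply: kln.
rewrite big_split /=.
have -> : \sum_y law Y y * - ln (weight y.2) = word_entropy weight (n + N).
  rewrite -(law_mean_comp nu mY snd (fun w : (n + N).-tuple bool => - ln (weight w))).
  rewrite /word_entropy /word_mean -sumrN; apply: eq_bigr => w _.
  by rewrite -[snd \o Y]/(prefix_tuple (n + N)) law_prefix mulrN.
rewrite -addrA [n%:R * e + _]addrC addrA; apply: lerD; first exact: word_entropyD.
pose f (j : 'I_n) (y : n.-tuple I * (n + N).-tuple bool) :=
  tnth y.1 j != g (take N (drop j y.2)).
rewrite (eq_bigr (fun y => law Y y * (n%:R * (e / 2)) +
   b * \sum_(j < n) law Y y * (f j y)%:R)); last first.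
  by move=> y _; rewrite mulrDr; congr (_ + _); rewrite mulrCA -mulr_sumr.
rewrite big_split /= -mulr_suml (law_sum1 nu mY) mul1r -mulr_sumr exchange_big /=.
rewrite [in leRHS](splitr e) mulrDr lerD2l.
apply: (@le_trans _ _ (b * \sum_(j < n) (e / 2 / b))); last first.
  rewrite sumr_const card_ord -[_ *+ n]mulr_natr.
  by rewrite (_ : b * _ = n%:R * (e / 2))//; field; rewrite gt_eqF.
rewrite ler_pM2l//; apply: ler_sum => j _.
rewrite -(law_mean_comp nu mY (f j) (fun c : bool => c%:R)) sum_bool mulr0 addr0 mulr1.
have -> : f j \o Y = (fun x => q x != g (prefix_word N x)) \o iter j left_shift.
  apply/funext => x; rewrite /f /Y /= tnth_mktuple drop_prefix_word take_prefix_word//.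
  by rewrite addnC -addnBA ?leq_addr// ltnW.
rewrite law_shift//; first by apply: ltW; move: hB; congr (pr nu _ < _); apply/seteqP; split.
move=> c; have mB' : measurable [set x | (q x != g (prefix_word N x)) = false].
  have := measurableC mB; congr measurable; apply/seteqP; split => x /=; first by move/negP/negbTE.
  by move=> ->.
by case: c.
Qed.

End kolmogorov_sinai.

(** * Entropy, Lyapunov exponent and pressure *)

Section limits.
Variable R : realType.
Implicit Types (a b : nat -> R).

Lemma limn_EFin a (l : R) : a @ \oo --> l -> limn (fun n => (a n)%:E) = l%:E.
Proof.
by move=> al; apply/cvg_lim => //; apply: cvg_EFin => //; exact: nearW.
Qed.

Lemma cvg_invn_bounded a C : (forall n, `|a n| <= C) ->
  (fun n => n%:R^-1 * a n) @ \oo --> (0 : R).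
Proof.
move=> aC; apply/cvgrPdist_lt => e e0.
have C0 : 0 <= C by apply: le_trans (aC 0%N).
exists (Num.bound (C / e)).+1 => // n /= Nn.
have n0 : 0 < n%:R :> R by rewrite ltr0n (leq_trans _ Nn).
rewrite sub0r normrN normrM ger0_norm ?invr_ge0 ?ltW// mulrC ltr_pdivrMr//.
apply: le_lt_trans (aC n) _; rewrite mulrC -ltr_pdivrMr//.
apply: lt_le_trans (archi_boundP _) _; first by rewrite divr_ge0// ltW.
by rewrite ler_nat ltnW.
Qed.

Lemma cvg_mean_bounded a P K : (forall n, `|a n - n%:R * P| <= K) ->
  (fun n => n%:R^-1 * a n) @ \oo --> P.
Proof.
move=> aK; have h : (fun n => P + n%:R^-1 * (a n - n%:R * P)) @ \oo --> P.
  by rewrite -[X in _ --> X]addr0; apply: cvgD; [exact: cvg_cst|exact: cvg_invn_bounded aK].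
apply: (cvg_trans _ h); apply: near_eq_cvg; exists 1%N => // n /= n0.
by rewrite mulrBr mulKf ?pnatr_eq0 -?lt0n// addrC subrK.
Qed.

(* [0 <= l] is needed because [limn u] is 0 when [u] has no limit. *)
Lemma limn_le (u : nat -> \bar R) a (l : R) : 0 <= l -> a @ \oo --> l ->
  (forall n, u n <= (a n)%:E)%E -> (limn u <= l%:E)%E.
Proof.
move=> l0 al ua; have [cu|ncu] := pselect (cvgn u).
  have ca : (fun n => (a n)%:E) @ \oo --> l%:E.
    by apply: cvg_EFin => //; exact: nearW.
  rewrite -(limn_EFin al); apply: lee_lim => //.
    exact: cvgP ca.
  exact: nearW.
by rewrite dvgP// lee_fin.
Qed.

End limits.

Lemma iter_left_shift j (x : Sigma2) i : iter j left_shift x i = x (i + j)%N.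
Proof. by elim: j i => [|j IH] i; rewrite ?addn0// iterS /left_shift IH addnS. Qed.

Section entropy.
Variables (R : realType) (nu : probability Sigma2 R).
Hypothesis inv : invariant_measure nu left_shift.
Local Notation weight := (cylinder_weight nu).
Let wP := cylinder_weightP inv.

Lemma partition_label k (P : 'I_k -> set Sigma2) : measurable_partition P ->
  exists q : Sigma2 -> 'I_k, forall i, q @^-1` [set i] = P i.
Proof.
move=> [_ tP cP].
have /choice[q hq] : forall x, exists i, P i x.
  by move=> x; have [i _ Pi] : (\bigcup_i P i) x by [rewrite cP]; exists i.
exists q => i; apply/seteqP; split => x /=; first by move=> <-.
by move=> Pi; apply: (tP (q x) i) => //; exists x; split.
Qed.

Lemma join_entropy_law k (P : 'I_k -> set Sigma2) (q : Sigma2 -> 'I_k) n :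
  (forall i, q @^-1` [set i] = P i) ->
  join_entropy nu left_shift P n = - \sum_(v : n.-tuple 'I_k)
    law nu (itinerary q n) v * ln (law nu (itinerary q n) v).
Proof.
move=> qP; rewrite /join_entropy; congr (- _); apply: eq_bigr => v _.
suff -> : join_cell left_shift P v = itinerary q n @^-1` [set v] by [].
apply/seteqP; split => x /= h.
  by apply: eq_from_tnth => j; rewrite tnth_mktuple; have := h j; rewrite -qP.
by move=> j; rewrite -qP /= -h tnth_mktuple.
Qed.

(** The supremum is attained by the partition according to the first symbol, whose joins are the
    cylinders, so its entropy at each [n] is [word_entropy]; other partitions are handled by
    [itinerary_entropy_le] with [e] tending to 0. *)
Lemma entropyE h : (fun n => n%:R^-1 * word_entropy weight n) @ \oo --> h -> 0 <= h ->
  entropy nu left_shift = h%:E.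
Proof.
move=> ch h0; apply/eqP; rewrite eq_le; apply/andP; split.
  apply: ge_ereal_sup => _ [k [P [mP ->]]].
  have [q qP] := partition_label mP; have [mPi _ _] := mP.
  have mq : finite_rv q by move=> i; rewrite qP.
  apply/lee_addgt0Pr => e e0; rewrite -EFinD.
  have [C HC] := itinerary_entropy_le inv mq e0.
  apply: (@limn_le _ _ (fun n => n%:R^-1 * word_entropy weight n + e + n%:R^-1 * C)).
  - by rewrite addr_ge0// ltW.
  - rewrite -[X in _ --> X]addr0; apply: cvgD; last exact: (@cvg_invn_bounded _ _ `|C|).
    by apply: cvgD => //; exact: cvg_cst.
  - move=> [|n]; first by rewrite lee_fin invr0 !mul0r add0r addr0 ltW.
    rewrite lee_fin (join_entropy_law _ qP).
    apply: le_trans (ler_wpM2l _ (HC n.+1)) _; first by rewrite invr_ge0.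
    by rewrite !mulrDr mulrA mulVf ?mul1r// pnatr_eq0.
pose q (x : Sigma2) : 'I_2 := inord (x 0%N).
have inordK' (b : bool) : (inord b : 'I_2) = b :> nat by rewrite inordK//; case: b.
have qb x : nat_of_ord (q x) = x 0%N by rewrite /q inordK'.
pose P (i : 'I_2) := q @^-1` [set i].
have mq : finite_rv q.
  have -> : q = (fun w : 1.-tuple bool => inord (thead w)) \o prefix_tuple 1.
    by apply/funext.
  by apply: (finite_rv_comp nu) => //; apply: finite_rv_prefix.
apply: ereal_sup_ubound; exists 2, P; split.
  split => //; first by move=> i j _ _ [x [/= <- <-]].
  by apply/seteqP; split => // x _; exists (q x).
rewrite /partition_entropy -(limn_EFin ch); congr (limn _); apply/funext => n.
congr (_ * _)%:E; rewrite (@join_entropy_law _ P q)// /word_entropy /word_mean; congr (- _).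
pose F (w : n.-tuple bool) : n.-tuple 'I_2 := [tuple inord (tnth w j) | j < n].
pose G (v : n.-tuple 'I_2) : n.-tuple bool := [tuple tnth v j == 1 :> nat | j < n].
have FG : cancel F G.
  by move=> w; apply: eq_from_tnth => j; rewrite !tnth_mktuple inordK'; case: (tnth w j).
have GF : cancel G F.
  move=> v; apply: eq_from_tnth => j; rewrite !tnth_mktuple; apply/val_inj => /=.
  by rewrite inordK'; case: (tnth v j) => [[|[|?]] ?].
rewrite (reindex F) /=; last by exists G => ? _; rewrite ?FG ?GF.
apply: eq_bigr => w _.
suff -> : law nu (itinerary q n) (F w) = weight w by [].
rewrite -law_prefix /law; congr pr; apply/seteqP; split => x /=.
  move=> e; rewrite -(FG w) -e; apply: eq_from_tnth => j.
  rewrite !tnth_mktuple qb iter_left_shift (tnth_nth false) /= nth_mkseq//.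
  by case: (x j).
move=> <-; apply: eq_from_tnth => j; rewrite !tnth_mktuple; apply/val_inj => /=.
by rewrite qb iter_left_shift inordK' (tnth_nth false) /= nth_mkseq.
Qed.

(** The integrand is a finite combination of indicators of cylinders; [1 <= Phi] makes the
    coefficients nonnegative, so the integral of nonnegative functions suffices. *)
Lemma Lyapunov_integral (Phi : seq bool -> R) n : (forall w, 1 <= Phi w) ->
  (\int[nu]_x (ln (Phi (prefix_word n x)))%:E)%E =
  (word_mean weight (fun w => ln (Phi w)) n)%:E.
Proof.
move=> P1.
have l0 w : 0 <= ln (Phi w) by apply: ln_ge0.
transitivity (\int[nu]_(x in setT) (\sum_(w : n.-tuple bool)
    ((ln (Phi w))%:E * (\1_(cylinder w) x)%:E)%E))%E.
  apply: eq_integral => x _.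
  rewrite (bigD1 (prefix_tuple n x))//= big1 ?adde0.
    by rewrite indicE mem_set ?mule1// cylinder_prefix.
  move=> w wx; rewrite indicE memNset ?mule0//.
  rewrite -prefix_tuple_preimage /= => e; by case/eqP: wx.
rewrite ge0_integral_sum//.
- rewrite /word_mean -sumEFin; apply: eq_bigr => w _.
  rewrite ge0_integralZl_EFin//.
  + rewrite integral_indic//; last exact: measurable_cylinder.
    rewrite setIT mulrC EFinM; congr (_ * _)%E.
    exact: (pr_fineK nu (measurable_cylinder w)).
  + by apply/measurable_EFinP; apply: measurable_indic; exact: measurable_cylinder.
- move=> w; apply: emeasurable_funM => //.
  by apply/measurable_EFinP; apply: measurable_indic; exact: measurable_cylinder.
- by move=> w x _; rewrite mule_ge0// lee_fin.
Qed.

Lemma LyapunovE (Phi : seq bool -> R) l : (forall w, 1 <= Phi w) ->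
  (fun n => n%:R^-1 * word_mean weight (fun w => ln (Phi w)) n) @ \oo --> l ->
  Lyapunov Phi nu = l%:E.
Proof.
move=> P1 cl; rewrite -(limn_EFin cl) /Lyapunov; congr (limn _); apply/funext => n.
by rewrite Lyapunov_integral.
Qed.

End entropy.

Lemma measurable_fun_left_shift : measurable_fun [set: Sigma2] left_shift.
Proof. by move=> _ A mA; rewrite setTI; apply: measurable_left_shift. Qed.

HB.instance Definition _ :=
  @isMeasurableFun.Build _ _ Sigma2 Sigma2 left_shift measurable_fun_left_shift.

(** * Existence and uniqueness of the equilibrium state *)

Section equilibrium.
Variables (R : realType) (u v : R).
Hypotheses (u1 : 1 < u) (v1 : 1 < v).
Variable Phi : seq bool -> R.
Hypothesis path_weight_le : forall z w, path_weight u v z w <= Phi w.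
Hypothesis path_weight_max : forall w, exists z, Phi w = path_weight u v z w.
Local Notation growth := (growth u v).
Let Phi1 := potential_ge1 u1 v1 path_weight_max.

Lemma pressureE : pressure Phi = (ln growth)%:E.
Proof.
have [K K0 HK] := potential_sum_bounds u1 v1 path_weight_le path_weight_max.
by apply: limn_EFin; exact: cvg_mean_bounded HK.
Qed.

(** Fekete's lemma applies to entropy and to the mean of [ln Phi] separately. The third clause
    serves uniqueness, the fourth existence. *)
Lemma mean_limits (nu : probability Sigma2 R) : invariant_measure nu left_shift ->
  exists h l, [/\ entropy nu left_shift = h%:E, Lyapunov Phi nu = l%:E,
    forall n, n%:R * (h + l) <= word_entropy (cylinder_weight nu) n
      + word_mean (cylinder_weight nu) (fun w => ln (Phi w)) n &
    (fun n => n%:R^-1 * (word_entropy (cylinder_weight nu) n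
      + word_mean (cylinder_weight nu) (fun w => ln (Phi w)) n)) @ \oo --> h + l].
Proof.
move=> inv; have wP := cylinder_weightP inv.
have [h [h0 hn ch]] := fekete (word_entropy_ge0 wP) (word_entropyD wP).
have L0 n : 0 <= word_mean (cylinder_weight nu) (fun w => ln (Phi w)) n.
  by apply: word_mean_ge0 => // w; apply: ln_ge0.
have LD n k : word_mean (cylinder_weight nu) (fun w => ln (Phi w)) (n + k) <=
    word_mean (cylinder_weight nu) (fun w => ln (Phi w)) n +
    word_mean (cylinder_weight nu) (fun w => ln (Phi w)) k.
  by apply: word_mean_cat => // w w'; apply: (ln_potential_cat u1 v1).
have [l [l0 ln' cl]] := fekete L0 LD.
exists h, l; split.
- exact: entropyE.
- exact: LyapunovE.
- by move=> n; rewrite mulrDr lerD.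
- under eq_fun do rewrite mulrDr.
  exact: cvgD.
Qed.

Lemma equilibrium_state_weight (nu : probability Sigma2 R) :
  equilibrium_state Phi nu -> cylinder_weight nu =1 gibbs_weight u v.
Proof.
move=> [inv]; have [h [l [-> -> Hn _]]] := mean_limits inv.
rewrite pressureE -EFinD => -[e]; apply: (gibbs_weight_unique u1 v1 path_weight_le) => //.
  exact: cylinder_weightP.
by move=> n; rewrite e.
Qed.

Lemma equilibrium_state_of_weight (nu : probability Sigma2 R) :
  (forall w, nu (cylinder w) = (gibbs_weight u v w)%:E) -> equilibrium_state Phi nu.
Proof.
move=> nuw; have gP := gibbs_weightP u1 v1.
have wE : cylinder_weight nu = gibbs_weight u v.
  by apply/funext => w; rewrite /cylinder_weight /pr nuw.
have inv : invariant_measure nu left_shift.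
  move=> A mA; rewrite -[LHS]/(distribution nu left_shift A).
  apply: probability_eq_cylinders => // w.
  rewrite -[LHS]/(nu (left_shift @^-1` cylinder w)) cylinder_cons.
  have [_ _ _ gl] := gP.
  rewrite measureU; try exact: measurable_cylinder.
    rewrite -[RHS]/(nu (cylinder w)) (nuw w) -gl sum_bool EFinD.
    by congr (_ + _)%E; apply: nuw.
  by apply/seteqP; split => // x []; rewrite /cylinder /= => -> [].
split => //; have [h [l [-> -> _]]] := mean_limits inv.
rewrite pressureE wE -EFinD => chl; congr EFin.
have [K K0 HK] := gibbs_free_energy u1 v1 path_weight_le path_weight_max.
by apply: (cvg_unique _ _ chl) => //; exact: cvg_mean_bounded HK.
Qed.

End equilibrium.

(** * Monomial matrices *)

Section matrices.
Variable R : realType.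

Lemma sum_ord2 (V : nmodType) (F : 'I_2 -> V) : \sum_i F i = F 0 + F 1.
Proof.
rewrite big_ord_recl big_ord1; congr (_ + F _); exact/val_inj.
Qed.

Lemma ord2P (P : 'I_2 -> Prop) : P 0 -> P 1 -> forall i, P i.
Proof.
move=> P0 P1 [[|[|//]] i].
  by rewrite (_ : Ordinal i = 0)//; apply/val_inj.
by rewrite (_ : Ordinal i = 1)//; apply/val_inj.
Qed.

Lemma mulmx_mx2 (a b c d a' b' c' d' : R) : mx2 a b c d * mx2 a' b' c' d' =
  mx2 (a * a' + b * c') (a * b' + b * d') (c * a' + d * c') (c * b' + d * d').
Proof.
by apply/matrixP; apply: ord2P; apply: ord2P; rewrite !mxE sum_ord2 !mxE.
Qed.

Lemma mulmx_mx2_col (a b c d : R) (w : 'cV[R]_2) :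
  (mx2 a b c d *m w) 0 0 = a * w 0 0 + b * w 1 0 /\
  (mx2 a b c d *m w) 1 0 = c * w 0 0 + d * w 1 0.
Proof. by rewrite !mxE !sum_ord2 !mxE. Qed.

Definition monomial_family (sw : bool) (d : bool -> R) (a : bool) : 'M[R]_2 :=
  if a == sw then mx2 0 1 1 0 else mx2 (d false) 0 0 (d true).

(** The only nonzero entry in row [s] of the matrix product: a swap letter passes to the other row,
    the other letter multiplies by a diagonal entry. *)
Fixpoint row_weight (sw : bool) (d : bool -> R) (w : seq bool) (s : bool) : R :=
  if w is a :: w' then
    if a == sw then row_weight sw d w' (~~ s) else d s * row_weight sw d w' s
  else 1.

Definition monomial_mx (e : bool) (p q : R) : 'M[R]_2 :=
  if e then mx2 0 p q 0 else mx2 p 0 0 q.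

Lemma word_product_monomial sw d w : word_product (monomial_family sw d) w =
  monomial_mx (odd (count (pred1 sw) w)) (row_weight sw d w false) (row_weight sw d w true).
Proof.
rewrite /word_product; elim: w => [|a w IH].
  rewrite big_nil /=; apply/matrixP; apply: ord2P; apply: ord2P; by rewrite !mxE.
rewrite big_cons IH /monomial_family /=; case: eqP => _ /=.
  by rewrite /monomial_mx; case: odd; rewrite /= mulmx_mx2 !(mul0r, mulr0, mul1r, addr0, add0r).
by rewrite /monomial_mx; case: odd; rewrite mulmx_mx2 !(mul0r, mulr0, addr0, add0r).
Qed.

Lemma euclidean_norm2 (w : 'cV[R]_2) : euclidean_norm w = Num.sqrt (w 0 0 ^+ 2 + w 1 0 ^+ 2).
Proof. by rewrite /euclidean_norm sum_ord2. Qed.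

Lemma operator_norm_monomial e (p q : R) : 0 < p -> 0 < q ->
  operator_norm (monomial_mx e p q) = Num.max p q.
Proof.
move=> p0 q0; set c := Num.max p q.
have [pc qc] : p <= c /\ q <= c by rewrite /c !le_max !lexx orbT.
have c0 : 0 < c by apply: lt_le_trans pc.
have p2 : p ^+ 2 <= c ^+ 2 by rewrite lerXn2r// nnegrE ltW.
have q2 : q ^+ 2 <= c ^+ 2 by rewrite lerXn2r// nnegrE ltW.
have sqn (w : 'cV[R]_2) : euclidean_norm (monomial_mx e p q *m w) =
    Num.sqrt (if e then p ^+ 2 * w 1 0 ^+ 2 + q ^+ 2 * w 0 0 ^+ 2
              else p ^+ 2 * w 0 0 ^+ 2 + q ^+ 2 * w 1 0 ^+ 2).
  rewrite euclidean_norm2 /monomial_mx; case: e.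
    by have [-> ->] := mulmx_mx2_col 0 p q 0 w; rewrite !mul0r addr0 add0r !exprMn.
  by have [-> ->] := mulmx_mx2_col p 0 0 q w; rewrite !mul0r addr0 add0r !exprMn.
have ub : ubound [set euclidean_norm (monomial_mx e p q *m w) |
    w in [set w : 'cV[R]_2 | euclidean_norm w <= 1]] c.
  move=> _ [w /= w1 <-]; rewrite sqn.
  have -> : c = Num.sqrt (c ^+ 2) by rewrite sqrtr_sqr gtr0_norm.
  rewrite ler_wsqrtr//.
  have {}w1 : w 0 0 ^+ 2 + w 1 0 ^+ 2 <= 1.
    by move: w1; rewrite euclidean_norm2 -[X in _ <= X]sqrtr1 ler_sqrt.
  have x0 := sqr_ge0 (w 0 0); have y0 := sqr_ge0 (w 1 0).
  apply: (@le_trans _ _ (c ^+ 2 * (w 0 0 ^+ 2 + w 1 0 ^+ 2))); last first.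
    by rewrite ler_piMr// sqr_ge0.
  rewrite mulrDr; case: e {sqn} => /=; first rewrite [leRHS]addrC.
    by apply: lerD; apply: ler_wpM2r.
  by apply: lerD; apply: ler_wpM2r.
have att i : operator_norm (monomial_mx e p q) >=
    euclidean_norm (monomial_mx e p q *m delta_mx i 0).
  apply: ub_le_sup; first by exists c.
  exists (delta_mx i 0) => //=; rewrite euclidean_norm2.
  by move: i; apply: ord2P; rewrite !mxE /= expr0n expr1n ?addr0 ?add0r sqrtr1.
have [atp atq] : p <= operator_norm (monomial_mx e p q) /\ q <= operator_norm (monomial_mx e p q).
  have a0 := att 0; have a1 := att 1; rewrite !sqn !mxE /= in a0 a1.
  move: a0 a1; rewrite expr0n expr1n !mulr0 !mulr1 !addr0 !add0r.
  by case: e {sqn ub att}; rewrite !sqrtr_sqr !gtr0_norm.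
apply/eqP; rewrite eq_le; apply/andP; split; last by rewrite /c ge_max atp.
apply: ge_sup => //; exists (euclidean_norm (monomial_mx e p q *m 0)).
by exists 0 => //=; rewrite euclidean_norm2 !mxE expr0n addr0 sqrtr0.
Qed.

(** A vector of [V] with nonzero coordinate [k] puts the basis vector [k] into [V], by subtracting
    it from its image under [M b]. The swap provides such a vector if needed, and then yields the
    other basis vector. *)
Lemma irreducible_monomial (M : bool -> 'M[R]_2) (a b : bool) (k : 'I_2) :
  M a = mx2 0 1 1 0 -> (forall w : 'cV[R]_2, M b *m w - w = w k 0 *: (delta_mx k 0 : 'cV[R]_2)) ->
  irreducible_pair M.
Proof.
move=> Ma Mb V HV.
have [->|V0] := eqVneq V 0%VS; [by left|right].
have J (w : 'cV[R]_2) : w \in V -> mx2 0 1 1 0 *m w \in V by rewrite -Ma; apply: HV.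
have Jd i : mx2 0 1 1 0 *m (delta_mx i 0 : 'cV[R]_2) = delta_mx (1 - i) 0 :> 'cV[R]_2.
  by apply/matrixP => j l; rewrite (ord1 l); move: j i;
     apply: ord2P; apply: ord2P; rewrite !mxE sum_ord2 !mxE /= ?mul0r ?mulr0 ?add0r ?addr0 ?mulr1.
have pk (w : 'cV[R]_2) : w \in V -> w k 0 != 0 -> (delta_mx k 0 : 'cV[R]_2) \in V.
  move=> wV wk; rewrite -(scale1r (delta_mx k 0 : 'cV[R]_2)) -(mulVf wk) -scalerA -Mb.
  by rewrite memvZ// memvB// HV.
have kV : (delta_mx k 0 : 'cV[R]_2) \in V.
  have vV := memv_pick V; have v0 : vpick V != 0 by rewrite vpick0.
  have [vk|vk] := eqVneq (vpick V k 0) 0; last exact: pk vk.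
  apply: (pk _ (J _ vV)); apply: contraNneq v0 => vk'.
  apply/eqP/matrixP => j l; rewrite (ord1 l) [RHS]mxE.
  have [h0 h1] := mulmx_mx2_col 0 1 1 0 (vpick V).
  clear Mb pk; move: k j vk vk' h0 h1; apply: ord2P; apply: ord2P => vk vk' h0 h1 //.
    by move: h0; rewrite vk' mul0r mul1r add0r.
  by move: h1; rewrite vk' mul0r mul1r addr0.
have aV i : (delta_mx i 0 : 'cV[R]_2) \in V.
  have kV' := J _ kV; rewrite Jd in kV'.
  clear Mb pk; move: k kV kV' i; apply: ord2P; rewrite ?subrr ?subr0 => kV kV'.
    exact: ord2P.
  exact: ord2P.
apply/vspaceP => w; rewrite memvf (matrix_sum_delta w) memv_suml// => i _.
by rewrite memv_suml// => j _; rewrite (ord1 j) memvZ.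
Qed.

End matrices.

(** * Alternating frequencies *)

Section alternating_sums.
Variable R : realType.

(* The word 112, whose frequencies along even and along odd times differ. *)
Definition parity_word : seq bool := [:: false; false; true].

Definition occ (w : seq bool) : R := (prefix parity_word w)%:R.

Fixpoint alt_occ n w : R := if n is n'.+1 then occ w - alt_occ n' (behead w) else 0.

Definition alt_sum n (x : Sigma2) : R := alt_occ n (prefix_word (n + 3) x).

Lemma occ01 w : 0 <= occ w <= 1.
Proof. by rewrite /occ; case: prefix; rewrite ?lexx ?ler01. Qed.

Lemma occ_depends : depends_on_first 3 occ.
Proof.
move=> w w' hw; have := @prefix_depends_on_first R parity_word 0 w w' hw.
by rewrite !subr0.
Qed.

Lemma alt_occ_depends n : depends_on_first (n + 3) (alt_occ n).
Proof.
elim: n => [//|n IH] [//|a w] w' /= hw.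
rewrite (IH w w')//; congr (_ - _); apply: (occ_depends (w := a :: w)).
exact: leq_trans (leq_addl _ _) hw.
Qed.

Lemma alt_occ_prefix n m x : (n + 3 <= m)%N -> alt_occ n (prefix_word m x) = alt_sum n x.
Proof.
move=> nm; rewrite -(cat_take_drop (n + 3) (prefix_word m x)) take_prefix_word//.
by apply: alt_occ_depends; rewrite size_prefix_word.
Qed.

Lemma alt_sumS n x : alt_sum n.+1 x = occ (prefix_word 3 x) - alt_sum n (left_shift x).
Proof.
rewrite -[LHS]/(occ (prefix_word (n.+1 + 3) x) - alt_occ n (behead (prefix_word (n.+1 + 3) x))).
rewrite [X in behead X]prefix_wordSl; congr (_ - _).
rewrite -(cat_take_drop 3 (prefix_word (n.+1 + 3) x)) take_prefix_word ?leq_addl//.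
by apply: occ_depends; rewrite size_prefix_word.
Qed.

Lemma alt_sum_step n x : `|alt_sum n.+1 x - alt_sum n x| <= 1.
Proof.
elim: n x => [|n IH] x.
  rewrite alt_sumS /alt_sum /= !subr0.
  by have /andP[h0 h1] := occ01 (prefix_word 3 x); rewrite ger0_norm.
have -> : alt_sum n.+2 x - alt_sum n.+1 x =
    - (alt_sum n.+1 (left_shift x) - alt_sum n (left_shift x)).
  by rewrite (alt_sumS n.+1) (alt_sumS n x); ring.
by rewrite normrN.
Qed.

(** Moving the origin by one exchanges even and odd times, so it reverses the sign of the sum up to
    boundary terms. *)
Lemma alt_sum_shift n x : `|alt_sum n (left_shift x) + alt_sum n x| <= 2.
Proof.
have h := alt_sum_step n x; move: (alt_sumS n x) => e.
have -> : alt_sum n (left_shift x) + alt_sum n x =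
  occ (prefix_word 3 x) - (alt_sum n.+1 x - alt_sum n x) by rewrite e; ring.
apply: le_trans (ler_normB _ _) _.
have /andP[h0 h1] := occ01 (prefix_word 3 x).
by rewrite ger0_norm//; lra.
Qed.

Lemma measurable_alt_sum n (A : set R) : measurable [set x | A (alt_sum n x)].
Proof. exact: (measurable_prefix (n + 3) [set w | A (alt_occ n w)]). Qed.

(** Positive linear growth of the alternating sum along powers of 2. The unspecified rate
    [m.+1%:R^-1] makes the set insensitive to bounded changes of the sum. *)
Definition drift_set : set Sigma2 :=
  \bigcup_m \bigcup_N \bigcap_(k in [set k | (N <= k)%N])
    [set x | (2 ^ k)%:R / m.+1%:R <= alt_sum (2 ^ k) x].

Lemma measurable_drift_set : measurable drift_set.
Proof.
apply: bigcup_measurable => m _; apply: bigcup_measurable => N _.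
apply: bigcap_measurableType => k _.
exact: (measurable_alt_sum _ [set r | (2 ^ k)%:R / m.+1%:R <= r]).
Qed.

Lemma drift_setP x C d N : 0 < d ->
  (forall k, (N <= k)%N -> (2 ^ k)%:R * d - C <= alt_sum (2 ^ k) x) -> drift_set x.
Proof.
move=> d0 H.
have d2 : 0 < d / 2 by rewrite divr_gt0.
(* Half of the rate [d] absorbs [C] for large [k]; the other half dominates [m.+1%:R^-1]. *)
pose m := Num.bound (d / 2)^-1; exists m => //.
have dm : m.+1%:R^-1 <= d / 2.
  rewrite -[leRHS]invrK lef_pV2 ?posrE ?invr_gt0//.
  apply: ltW; apply: lt_le_trans (archi_boundP _) _; first by rewrite invr_ge0 ltW.
  by rewrite ler_nat.
pose N' := Num.bound (`|C| / (d / 2)); exists (maxn N N') => // k /=.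
rewrite geq_max => /andP[Nk N'k].
apply: le_trans (H k Nk).
have h1 : (2 ^ k)%:R / m.+1%:R <= (2 ^ k)%:R * (d / 2) :> R by rewrite ler_wpM2l.
have h2 : C <= (2 ^ k)%:R * (d / 2).
  apply: le_trans (ler_norm _) _; rewrite -ler_pdivrMr//; apply: ltW.
  apply: lt_le_trans (archi_boundP _) _; first by rewrite divr_ge0// ltW.
  by rewrite ler_nat; apply: leq_trans N'k _; rewrite ltnW// ltn_expl.
apply: (le_trans h1); rewrite lerBrDr; apply: le_trans (lerD (lexx _) h2) _.
by rewrite -mulrDr -splitr.
Qed.

Lemma drift_setE x : drift_set x -> exists d N, 0 < d /\
  forall k, (N <= k)%N -> (2 ^ k)%:R * d <= alt_sum (2 ^ k) x.
Proof. by move=> [m _ [N _ H]]; exists m.+1%:R^-1, N; split. Qed.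

Lemma drift_set_shift2 : iter 2 left_shift @^-1` drift_set = drift_set.
Proof.
have s2 n x : `|alt_sum n (left_shift (left_shift x)) - alt_sum n x| <= 4.
  have h1 := alt_sum_shift n x; have h2 := alt_sum_shift n (left_shift x).
  move: h1 h2; rewrite !ler_norml => /andP[? ?] /andP[? ?]; apply/andP; split; lra.
apply/seteqP; split => x /= /drift_setE[d [N [d0 H]]]; apply: (@drift_setP _ 4 d N) => // k Nk;
  have := s2 (2 ^ k)%N x; have := H k Nk; rewrite ler_norml => ? /andP[? ?]; lra.
Qed.

Lemma drift_set_disjoint : drift_set `&` left_shift @^-1` drift_set = set0.
Proof.
apply/seteqP; split => // x [/drift_setE[d [N [d0 H]]] /drift_setE[d' [N' [d'0 H']]]].
have [k [kN kN' kd]] : exists k, [/\ (N <= k)%N, (N' <= k)%N & 2 < (2 ^ k)%:R * d].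
  pose M := Num.bound (2 / d); exists (maxn N (maxn N' M)).
  split; rewrite ?leq_maxl// ?leq_max ?leqnn ?orbT//.
  rewrite -ltr_pdivrMr//; apply: lt_le_trans (archi_boundP _) _; first by rewrite divr_ge0// ltW.
  rewrite ler_nat -/M; apply: (leq_trans (ltnW (ltn_expl M (ltnSn 1)))).
  by rewrite leq_exp2l// !leq_max leqnn !orbT.
have := H k kN; have := H' k kN'; have := alt_sum_shift (2 ^ k) x.
rewrite ler_norml => /andP[h1 h2] h3 h4.
have h5 : 0 <= (2 ^ k)%:R * d' by rewrite mulr_ge0// ltW.
lra.
Qed.

Definition drift_event N d : set Sigma2 := [set x | exists e : bool,
  forall k, (N <= k)%N -> (2 ^ k)%:R * d <= (-1) ^+ e * alt_sum (2 ^ k) x].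

Lemma drift_event_sub N d : 0 < d -> drift_event N d `<=` drift_set `|` left_shift @^-1` drift_set.
Proof.
move=> d0 x [[] H].
  right; apply: (@drift_setP _ 2 d N) => // k Nk.
  have := H k Nk; have := alt_sum_shift (2 ^ k) x.
  rewrite expr1 mulN1r ler_norml => /andP[? ?] ?; lra.
left; apply: (@drift_setP _ 0 d N) => // k Nk.
by have := H k Nk; rewrite expr0 mul1r subr0.
Qed.

Definition drift_word N d K (w : seq bool) := exists e : bool,
  forall k, (N <= k <= K)%N -> (2 ^ k)%:R * d <= (-1) ^+ e * alt_occ (2 ^ k) w.

(** The sign may vary with [K], but there are only two of them: if each failed at some time, none
    would work up to the later of these two times. *)
Lemma drift_event_bigcap N d : drift_event N d =
  \bigcap_K [set x | drift_word N d K (prefix_word (2 ^ K + 3) x)].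
Proof.
apply/seteqP; split => x.
  move=> [e H] K _; exists e => k /andP[Nk kK].
  by rewrite alt_occ_prefix ?H// leq_add2r leq_exp2l.
move=> H; apply: contrapT => /forallNP nH.
have nE (e : bool) : exists k, (N <= k)%N /\ ~ ((2 ^ k)%:R * d <= (-1) ^+ e * alt_sum (2 ^ k) x).
  by have /existsNP[k /not_implyP[? ?]] := nH e; exists k.
have [k1 [N1 n1]] := nE true; have [k2 [N2 n2]] := nE false.
have [e He] := H (maxn k1 k2) I.
have hh k : (N <= k)%N -> (k <= maxn k1 k2)%N -> (2 ^ k)%:R * d <= (-1) ^+ e * alt_sum (2 ^ k) x.
  move=> Nk kk; rewrite -(@alt_occ_prefix _ (2 ^ maxn k1 k2 + 3)%N).
    by apply: He; rewrite Nk.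
  by rewrite leq_add2r leq_exp2l.
by case: e He hh => _ hh; [apply: n1; apply: hh|apply: n2; apply: hh]; rewrite // ?leq_maxl ?leq_maxr.
Qed.

Lemma measurable_drift_event N d : measurable (drift_event N d).
Proof.
rewrite drift_event_bigcap; apply: bigcap_measurableType => K _.
exact: (measurable_prefix _ [set w | drift_word N d K w]).
Qed.

End alternating_sums.

(** * Concentration of the alternating frequency *)

Section drift.
Variables (R : realType) (u v : R).
Hypotheses (u1 : 1 < u) (v1 : 1 < v).
Local Notation chain_mean := (chain_mean u v).
Local Notation stationary_mean := (stationary_mean u v).
Local Notation perron := (perron u v).
Local Notation growth := (growth u v).
Local Notation gibbs_weight := (gibbs_weight u v).
Local Notation occ := (occ R).
Local Notation alt_occ := (alt_occ R).

Definition parity_sign (z : bool * bool) : R := if z.1 == z.2 then 1 else -1.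

(** The part of the stationary frequency of 112 that starts in the class [z.1 = z.2], minus the part
    that starts in the other class. For a single letter this difference vanishes, since an edge
    carries the same flow from both of its ends. *)
Definition drift : R := stationary_mean (fun z => parity_sign z * chain_mean 3 z occ).

Lemma chain_mean_occ z : chain_mean 3 z occ =
  path_weight u v z parity_word * perron (foldl step z parity_word) / (growth ^+ 3 * perron z).
Proof.
rewrite chain_mean_sum// (bigD1 [tuple of parity_word])// big1 => [|w wU].
  by rewrite [LHS]addr0 /occ prefix_refl mulr1.
rewrite /occ prefixE take_oversize ?size_tuple//.
by case: eqP => [e|_]; [case/eqP: wU; apply/val_inj|rewrite mulr0].
Qed.

Lemma drift_lt0 : drift < 0.
Proof.
have l0 := growth_gt0 u1 v1; have p0 := perron_gt0 u1 v1; have m0 := mass_gt0 u1 v1.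
have -> : drift = - ((u ^+ 2 - 1) / (mass u v * growth ^+ 3)) *
    (v * perron (false, true) * perron (true, true)
     - perron (true, false) * perron (false, false)).
  rewrite /drift /stationary_mean sum_state !chain_mean_occ /parity_sign.
  move: (mass u v) m0 perron p0 => m m0 h p0 /=.
  by rewrite /letter_weight /=; field; rewrite !gt_eqF.
rewrite mulNr oppr_lt0 mulr_gt0//.
  by rewrite divr_gt0// ?subr_gt0 ?exprn_egt1// mulr_gt0// exprn_gt0.
have c0 : 0 < growth2 u v - 2 by rewrite subr_gt0 growth2_gt2.
have [u0 v0] : 0 < u /\ 0 < v by split; apply: lt_trans ltr01 _.
(* The factorisation appears after reducing [growth2 ^+ 2] by its quadratic equation; every factor
   is positive since [v > 1] and [growth2 > 2]. *)
rewrite /= (_ : _ - _ = (v ^+ 2 - 1) *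
   ((growth2 u v - 2) * (u ^+ 2 + v ^+ 2) + (u + v) ^+ 2) / growth).
  rewrite divr_gt0// mulr_gt0 ?subr_gt0 ?exprn_egt1//.
  by rewrite addr_gt0 ?exprn_gt0 ?addr_gt0// mulr_gt0// addr_gt0 ?exprn_gt0.
have e := growth2_eq u v.
have -> : v * (growth2 u v - 2) * ((v * (growth2 u v - 2) + (u + v)) / growth) -
    (u + v) * ((u * (growth2 u v - 2) + (u + v)) / growth) =
  (v ^+ 2 * growth2 u v ^+ 2 + (- 4 * v ^+ 2 + v * (u + v) - u * (u + v)) * growth2 u v
   + (4 * v ^+ 2 - 2 * v * (u + v) + 2 * u * (u + v) - (u + v) ^+ 2)) / growth.
  by field; rewrite gt_eqF.
by rewrite e; congr (_ / _); ring.
Qed.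

Definition drift_function (z : bool * bool) (w : seq bool) : R := parity_sign z * occ w - drift.

Lemma birkhoff_drift n z w :
  birkhoff step drift_function n z w = parity_sign z * alt_occ n w - n%:R * drift.
Proof.
elim: n z w => [|n IH] z w /=; first by rewrite mulr0 mul0r subr0.
rewrite IH (_ : parity_sign (step z (head false w)) = - parity_sign z).
  by rewrite /drift_function -nat1r; ring.
by rewrite /parity_sign; case: (head _ _); case: z => [[] []]; rewrite /= ?opprK.
Qed.

Lemma birkhoff_depends (f : bool * bool -> seq bool -> R) j n z : (0 < j)%N ->
  (forall z, depends_on_first j (f z)) ->
  depends_on_first (n + j) (birkhoff step f n z).
Proof.
move=> j0 fj; elim: n z => [//|n IH] z [|a w] w' /=; first by rewrite addSn.
by move=> h; rewrite IH// (fj z (a :: w))//; exact: leq_trans (leq_addl _ _) h.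
Qed.

Lemma sum_pow2V N M : \sum_(N <= k < M) ((2 ^ k)%:R^-1 : R) <= 2 * (2 ^ N)%:R^-1.
Proof.
(* The tail of the geometric series is added to make the induction go through; [maxn] covers empty
   ranges. *)
suff : \sum_(N <= k < M) ((2 ^ k)%:R^-1 : R) + 2 * (2 ^ (maxn N M))%:R^-1 <= 2 * (2 ^ N)%:R^-1.
  by apply: le_trans; rewrite lerDl mulr_ge0// invr_ge0.
elim: M => [|M IH]; first by rewrite big_geq// add0r maxn0.
have [NM|MN] := leqP N M; last by rewrite big_geq// add0r (maxn_idPl _).
rewrite big_nat_recr//= (maxn_idPr (leqW NM)); move: IH; rewrite (maxn_idPr NM).
apply: le_trans; rewrite -addrA lerD2l expnS natrM invfM mulrA divff ?pnatr_eq0// mul1r.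
by rewrite mulr2n mulrDl mul1r.
Qed.

Lemma stationary_chain_sum M (r : seq nat) (F : nat -> bool * bool -> seq bool -> R) :
  stationary_mean (fun z => chain_mean M z (fun w => \sum_(k <- r) F k z w)) =
  \sum_(k <- r) stationary_mean (fun z => chain_mean M z (F k z)).
Proof.
elim: r => [|k r IH].
  rewrite big_nil -[RHS](stationary_mean_cst u1 v1 0); congr stationary_mean.
  apply/funext => z; rewrite -[RHS](chain_mean_cst u1 v1 M z).
  by apply: chain_mean_ext => w; rewrite big_nil.
rewrite big_cons -IH -stationary_meanD; congr stationary_mean; apply/funext => z.
by rewrite -chain_meanD; apply: chain_mean_ext => w; rewrite big_cons.
Qed.

(** Chebyshev's inequality at each time [2 ^ k] and a union bound over [N <= k <= K], with [N]
    independent of [K]. *)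
Lemma drift_word_mean : exists (d : R) N, 0 < d /\ forall K,
  2^-1 <= word_mean gibbs_weight (fun w => (`[< drift_word N d K w >])%:R) (2 ^ K + 3).
Proof.
(* Half of the absolute drift: a deviation below [d] per unit of time still leaves growth at rate
   [d]. *)
pose d : R := - drift / 2.
have d0 : 0 < d by rewrite divr_gt0// oppr_gt0 drift_lt0.
have fj z : depends_on_first 3 (drift_function z).
  by move=> w w' hw; rewrite /drift_function occ_depends.
have fK z w : `|drift_function z w| <= 1 + `|drift|.
  apply: le_trans (ler_normB _ _) _; rewrite lerD2r normrM.
  have -> : `|parity_sign z| = 1 by rewrite /parity_sign; case: eqP; rewrite ?normrN normr1.
  by have /andP[h0 h1] := occ01 R w; rewrite mul1r ger0_norm.
have f0 : stationary_mean (fun z => chain_mean 3 z (drift_function z)) = 0.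
  transitivity (drift + stationary_mean (fun=> - drift)).
    rewrite -stationary_meanD; congr stationary_mean; apply/funext => z.
    by rewrite -chain_meanM -[- drift in RHS](chain_mean_cst u1 v1 3 z) -chain_meanD.
  by rewrite stationary_mean_cst// subrr.
have [C C0 HC] := birkhoff_variance u1 v1 fj fK f0.
(* The failure probability at time [2 ^ k] is at most [C / d ^+ 2 / 2 ^ k]; the sum over [k >= N]
   has to be at most one half. *)
have [N HN] : exists N, C / d ^+ 2 * (2 * (2 ^ N)%:R^-1) <= 2^-1.
  pose B := C / d ^+ 2 * 4; exists (Num.bound `|B|).
  rewrite mulrA ler_pdivrMr ?ltr0n ?expn_gt0//.
  rewrite (_ : C / d ^+ 2 * 2 = 2^-1 * B); last by rewrite /B; field; rewrite gt_eqF.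
  rewrite ler_pM2l ?invr_gt0//; apply: le_trans (ler_norm _) _; apply: ltW.
  apply: lt_le_trans (archi_boundP (normr_ge0 _)) _.
  by rewrite ler_nat ltnW// ltn_expl.
exists d, N; split => // K; set M := (2 ^ K + 3)%N.
pose F k z w := (birkhoff step drift_function (2 ^ k) z w) ^+ 2 / ((2 ^ k)%:R * d) ^+ 2.
have pos k : 0 < (2 ^ k)%:R :> R by rewrite ltr0n expn_gt0.
have FL k : (k <= K)%N -> stationary_mean (fun z => chain_mean M z (F k z)) <=
    C / d ^+ 2 * (2 ^ k)%:R^-1.
  move=> kK; have kM : (2 ^ k + 3 <= M)%N by rewrite leq_add2r leq_exp2l.
  have -> : stationary_mean (fun z => chain_mean M z (F k z)) =
      ((2 ^ k)%:R * d) ^- 2 * stationary_mean (fun z => chain_mean (2 ^ k + 3) z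
        (fun w => birkhoff step drift_function (2 ^ k) z w ^+ 2)).
    rewrite /stationary_mean mulrA mulr_sumr; congr (_ / _); apply: eq_bigr => z _.
    rewrite [RHS]mulrCA; congr (_ * _); rewrite -chain_meanM.
    rewrite -(subnKC kM) chain_mean_first//.
      by apply: chain_mean_ext => w; rewrite /F mulrC.
    by move=> w w' hw; rewrite /F (birkhoff_depends (j := 3)).
  have -> : C / d ^+ 2 / (2 ^ k)%:R = ((2 ^ k)%:R * d) ^- 2 * ((2 ^ k)%:R * C).
    by field; rewrite !gt_eqF.
  by apply: ler_wpM2l (HC _); rewrite invr_ge0 sqr_ge0.
rewrite word_mean_gibbs_weight//.
apply: (@le_trans _ _ (stationary_mean (fun z => chain_mean M z
   (fun w => 1 - \sum_(N <= k < K.+1) F k z w)))); last first.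
  apply: stationary_mean_le => // z; apply: chain_mean_le => // w.
  have F0 k : 0 <= F k z w by rewrite divr_ge0// sqr_ge0.
  case: asboolP => [_|nd]; first by rewrite lerBlDr lerDl sumr_ge0.
  have [k [/andP[Nk kK] hk]] : exists k, (N <= k <= K)%N /\
      (2 ^ k)%:R * d <= `|birkhoff step drift_function (2 ^ k) z w|.
    apply: contrapT => /forallNP H; apply: nd.
    (* Since [drift] is negative, the class with [parity_sign z = 1] sees negative alternating sums
       and needs the sign -1. *)
    exists (z.1 == z.2) => k Nk.
    have : `|birkhoff step drift_function (2 ^ k) z w| < (2 ^ k)%:R * d.
      by rewrite ltNge; apply/negP => h; apply: (H k).
    rewrite birkhoff_drift.
    have e : drift = - (2 * d) by rewrite /d; field.
    rewrite e /parity_sign ltr_norml => /andP[h1 h2].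
    by move: h1 h2; case: eqP => _; rewrite ?expr1 ?expr0 ?mul1r ?mulN1r => h1 h2; lra.
  rewrite mulr0n subr_le0 (@bigD1_seq _ _ _ _ _ k) ?iota_uniq//=; last first.
    by rewrite mem_index_iota Nk ltnS.
  apply: ler_wpDr; first exact: sumr_ge0.
  have dk : 0 < (2 ^ k)%:R * d by exact: mulr_gt0.
  rewrite /F ler_pdivlMr ?mul1r ?exprn_gt0//.
  rewrite -(@real_normK _ (birkhoff _ _ _ _ _)) ?num_real//.
  by rewrite lerXn2r// nnegrE ?normr_ge0// ltW.
have -> : stationary_mean (fun z => chain_mean M z (fun w => 1 - \sum_(N <= k < K.+1) F k z w))
    = 1 - \sum_(N <= k < K.+1) stationary_mean (fun z => chain_mean M z (F k z)).
  apply: (addIr (stationary_mean (fun z => chain_mean M z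
    (fun w => \sum_(N <= k < K.+1) F k z w)))).
  rewrite -stationary_chain_sum subrK -stationary_meanD.
  rewrite -[RHS](stationary_mean_cst u1 v1); congr stationary_mean; apply/funext => z.
  rewrite -chain_meanD -[RHS](chain_mean_cst u1 v1 M z); apply: chain_mean_ext => w.
  by rewrite subrK.
rewrite lerBrDr -lerBrDl (_ : 1 - 2^-1 = 2^-1 :> R); last by field.
apply: le_trans HN; apply: (@le_trans _ _ (\sum_(N <= k < K.+1) C / d ^+ 2 * (2 ^ k)%:R^-1)).
  rewrite big_nat_cond [leRHS]big_nat_cond; apply: ler_sum => k.
  by rewrite andbT ltnS => /andP[_ kK]; apply: FL.
by rewrite -mulr_sumr ler_wpM2l ?sum_pow2V// divr_ge0// sqr_ge0.
Qed.

End drift.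

(** * The theorem *)

Lemma pr_prefix (R : realType) (mu : probability Sigma2 R) n (S : set (seq bool)) :
  pr mu [set x | S (prefix_word n x)] =
  word_mean (cylinder_weight mu) (fun w => (`[< S w >])%:R) n.
Proof.
have [_ e] := law_pred mu (finite_rv_prefix (n := n)) (fun w : n.-tuple bool => `[< S w >]).
transitivity (\sum_(w : n.-tuple bool | `[< S w >]) law mu (prefix_tuple n) w).
  rewrite -e; congr pr; apply/seteqP; split => x /=; first by move=> ?; apply/asboolP.
  by move/asboolP.
rewrite big_mkcond; apply: eq_bigr => w _; rewrite law_prefix.
by case: asboolP; rewrite ?mulr1 ?mulr0.
Qed.

Section not_totally_ergodic.
Variables (R : realType) (u v : R).
Hypotheses (u1 : 1 < u) (v1 : 1 < v).
Variable mu : probability Sigma2 R.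
Hypothesis inv : invariant_measure mu left_shift.
Hypothesis muE : cylinder_weight mu = gibbs_weight u v.

Lemma drift_event_ge : exists (d : R) N, 0 < d /\ 2^-1 <= pr mu (drift_event N d).
Proof.
have [d [N [d0 H]]] := drift_word_mean u1 v1; exists d, N; split => //.
pose F K : set Sigma2 := [set x | drift_word N d K (prefix_word (2 ^ K + 3) x)].
have mF K : measurable (F K) by exact: (measurable_prefix _ [set w | drift_word N d K w]).
have cF : (mu \o F) @ \oo --> mu (drift_event N d).
  rewrite drift_event_bigcap; apply: nonincreasing_cvg_mu => //.
  - by rewrite ltey_eq fin_num_measure.
  - by rewrite -drift_event_bigcap; exact: measurable_drift_event.
  - move=> n m nm; apply/subsetPset => x [e He]; exists e => k /andP[Nk kn].
    have knm : (2 ^ k + 3 <= 2 ^ n + 3)%N by rewrite leq_add2r leq_exp2l.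
    rewrite alt_occ_prefix// -(@alt_occ_prefix _ _ (2 ^ m + 3)).
      by apply: He; rewrite Nk (leq_trans kn nm).
    by apply: leq_trans knm _; rewrite leq_add2r leq_exp2l.
rewrite -lee_fin -(pr_fineK mu (measurable_drift_event _ _)).
rewrite -(cvg_lim _ cF)//; apply: lime_ge; first exact: cvgP cF.
apply: nearW => K /=; rewrite (pr_fineK mu (mF K)) lee_fin /F.
by rewrite (pr_prefix mu _ [set w | drift_word N d K w]) muE; exact: H.
Qed.

(** [drift_set] and its preimage are disjoint with equal mass p, and their union contains an event
    of mass at least 1/2. So 1/2 <= 2p <= 1, which excludes 0 and 1, although the set is invariant
    under the squared shift. *)
Lemma gibbs_not_totally_ergodic : ~ totally_ergodic mu.
Proof.
move=> /(_ 2 isT _ (measurable_drift_set R) (drift_set_shift2 R)).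
have mD := measurable_drift_set R; have mS := measurable_left_shift mD.
have [d [N [d0 h]]] := drift_event_ge.
have eS : pr mu (left_shift @^-1` drift_set R) = pr mu (drift_set R).
  by rewrite /pr inv.
have h1 := prU mu mD mS (drift_set_disjoint R).
have h2 : pr mu (drift_event N d) <= pr mu (drift_set R `|` left_shift @^-1` drift_set R).
  apply: pr_le; [exact: measurable_drift_event|exact: (measurableU _ _ mD mS)|exact: drift_event_sub].
have h3 : pr mu (drift_set R `|` left_shift @^-1` drift_set R) <= 1.
  by rewrite -(pr_setT mu); apply: pr_le => //; apply: measurableU.
rewrite h1 eS in h2 h3.
case=> e; [have e' : pr mu (drift_set R) = 0 by rewrite /pr e
  |have e' : pr mu (drift_set R) = 1 by rewrite /pr e]; rewrite e' in h2 h3; lra.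
Qed.

End not_totally_ergodic.

(** * The norm potential as a maximum of path weights *)

Section norm_potential.
Variable R : realType.

Definition scaleA (s : bool) : R := if s then 1 else 2.
Definition scaleB (t : bool) : R := if t then 2 else 1.

Lemma matAE : matA R = monomial_family true scaleA.
Proof. by apply/funext => -[]. Qed.

Lemma matBE : matB R = monomial_family false scaleB.
Proof. by apply/funext => -[]. Qed.

Lemma row_weight_gt0 sw (d : bool -> R) w s : (forall s, 0 < d s) -> 0 < row_weight sw d w s.
Proof.
by move=> d0; elim: w s => //= a w IH s; case: ifP => _; rewrite ?mulr_gt0.
Qed.

Lemma operator_norm_word sw (d : bool -> R) w : (forall s, 0 < d s) ->
  operator_norm (word_product (monomial_family sw d) w) =
  Num.max (row_weight sw d w false) (row_weight sw d w true).
Proof.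
by move=> d0; rewrite word_product_monomial operator_norm_monomial ?row_weight_gt0.
Qed.

Lemma scaleA_gt0 s : 0 < scaleA s. Proof. by case: s. Qed.
Lemma scaleB_gt0 s : 0 < scaleB s. Proof. by case: s. Qed.

Variables beta1 beta2 : R.
Hypotheses (b1 : 0 < beta1) (b2 : 0 < beta2).

Lemma path_weight_rows z w : path_weight (2 `^ beta1) (2 `^ beta2) z w =
  row_weight true scaleA w z.1 `^ beta1 * row_weight false scaleB w z.2 `^ beta2.
Proof.
have rA w' s := ltW (row_weight_gt0 true w' s scaleA_gt0).
have rB w' s := ltW (row_weight_gt0 false w' s scaleB_gt0).
elim: w z => [|a w IH] [s t] /=; first by rewrite !powR1 mulr1.
rewrite IH /letter_weight /step; case: a => /=.
  by rewrite powRM ?rB ?(ltW (scaleB_gt0 _))//; case: t => /=; rewrite ?powR1 mulrCA.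
by rewrite powRM ?rA ?(ltW (scaleA_gt0 _))//; case: s => /=; rewrite ?powR1 mulrA.
Qed.

Lemma path_weight_le_norm z w :
  path_weight (2 `^ beta1) (2 `^ beta2) z w <= norm_potential beta1 beta2 w.
Proof.
rewrite path_weight_rows /norm_potential matAE matBE !operator_norm_word;
  [|exact: scaleB_gt0|exact: scaleA_gt0].
have rA s := ltW (row_weight_gt0 true w s scaleA_gt0).
have rB s := ltW (row_weight_gt0 false w s scaleB_gt0).
apply: ler_pM; rewrite ?powR_ge0//; apply: ge0_ler_powR;
  rewrite ?nnegrE ?le_max ?rA ?rB ?(ltW b1) ?(ltW b2)//.
  by case: z.1; rewrite lexx ?orbT.
by case: z.2; rewrite lexx ?orbT.
Qed.

Lemma path_weight_norm w : exists z,
  norm_potential beta1 beta2 w = path_weight (2 `^ beta1) (2 `^ beta2) z w.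
Proof.
have mx (f : bool -> R) : exists s, Num.max (f false) (f true) = f s.
  by case: leP => _; [exists true|exists false].
have [s es] := mx (row_weight true scaleA w).
have [t et] := mx (row_weight false scaleB w).
exists (s, t); rewrite path_weight_rows /norm_potential matAE matBE.
by rewrite !operator_norm_word ?es ?et//; [exact: scaleB_gt0|exact: scaleA_gt0].
Qed.

End norm_potential.

Theorem proposition2p3 (R : realType) :
  [/\ forall a, matA R a \in unitmx,
      forall a, matB R a \in unitmx,
      irreducible_pair (matA R),
      irreducible_pair (matB R)
    & forall beta1 beta2 : R, 0 < beta1 -> 0 < beta2 ->
      (forall w : seq bool, w != [::] -> 0 < norm_potential beta1 beta2 w) /\
      exists mu : probability Sigma2 R,
        [/\ equilibrium_state (norm_potential beta1 beta2) mu,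
            forall nu : probability Sigma2 R,
              equilibrium_state (norm_potential beta1 beta2) nu ->
              forall A : set Sigma2, measurable A -> nu A = mu A
          & ~ totally_ergodic mu]].
Proof.
have unit2 (A B : 'M[R]_2) : A * B = mx2 1 0 0 1 -> A \in unitmx.
  have -> : mx2 1 0 0 1 = 1%:M :> 'M[R]_2.
    by apply/matrixP; apply: ord2P; apply: ord2P; rewrite !mxE.
  by move/mulmx1_unit => [].
have unitJ : mx2 0 1 1 0 \in @unitmx R 2.
  by apply: (unit2 _ (mx2 0 1 1 0)); rewrite mulmx_mx2; congr mx2; ring.
split.
- case => //=; apply: (unit2 _ (mx2 2^-1 0 0 1)).
  by rewrite mulmx_mx2; congr mx2; field.
- case => //=; apply: (unit2 _ (mx2 1 0 0 2^-1)).
  by rewrite mulmx_mx2; congr mx2; field.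
- apply: (@irreducible_monomial _ _ true false 0) => // w.
  have [h0 h1] := mulmx_mx2_col 2 0 0 1 w.
  apply/matrixP => i j; rewrite (ord1 j) mxE [(- w) _ _]mxE.
  by move: i; apply: ord2P; rewrite [matA _ _]/= ?h0 ?h1 !mxE /=; ring.
- apply: (@irreducible_monomial _ _ false true 1) => // w.
  have [h0 h1] := mulmx_mx2_col 1 0 0 2 w.
  apply/matrixP => i j; rewrite (ord1 j) mxE [(- w) _ _]mxE.
  by move: i; apply: ord2P; rewrite [matB _ _]/= ?h0 ?h1 !mxE /=; ring.
move=> beta1 beta2 b1 b2.
(* Positivity of the exponents enters here, as [u > 1] and [v > 1]; the strict inequalities make the
   drift nonzero. *)
have pow1 b : 0 < b -> 1 < 2 `^ b :> R.
  move=> b0; have := gt0_ltr_powR b0 (x := 1) (y := 2).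
  by rewrite powR1 !nnegrE ltr1n; apply.
have u1 := pow1 _ b1; have v1 := pow1 _ b2.
have ple := path_weight_le_norm b1 b2.
have pmax := path_weight_norm beta1 beta2.
split; first by move=> w _; exact: (potential_gt0 u1 v1 pmax w).
have gP := gibbs_weightP u1 v1; have [g1 g0 gr _] := gP.
have [mu muE] := cylinder_measure_exists g1 g0 gr.
have eqmu := equilibrium_state_of_weight u1 v1 ple pmax muE.
exists mu; split => //.
- move=> nu eqnu; apply: probability_eq_cylinders => w.
  rewrite muE (pr_fineK nu (measurable_cylinder w)).
  by rewrite -(equilibrium_state_weight u1 v1 ple pmax eqnu).
- apply: (gibbs_not_totally_ergodic u1 v1); first by case: eqmu.
  by apply/funext => w; rewrite /cylinder_weight /pr muE.
Qed.
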